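(* On a lattice graph with uniform spacing $\Delta x$, the semi-discretization (continuous in time, discrete in space) $$\frac{d\rho_i}{dt}=\frac{1}{\Delta x^2}\Big\{\sum_{j\in N(i)}\rho_j\,(F_j(\rho)-F_i(\rho))_+-\sum_{j\in N(i)}\rho_i\,(F_i(\rho)-F_j(\rho))_+\Big\},\qquad i\in \mathcal V,$$ is a consistent finite volume scheme for the nonlinear Fokker-Planck equation $$\frac{\partial\rho}{\partial t}=\nabla\cdot\Big[\rho\,\nabla\Big(V(x)+\int_{\mathbb{R}^d}W(x,y)\rho(t,y)\,dy\Big)\Big]+\beta\Delta\rho .$$
   Context: The unknown $\rho(t,\cdot)$ of the Fokker-Planck equation is a probability density on $\mathbb{R}^d$ (the underlying space may also be another domain, for instance a bounded open set with zero-flux or periodic conditions). The functions $V:\mathbb{R}^d\to\mathbb{R}$ and $W:\mathbb{R}^d\times\mathbb{R}^d\to\mathbb{R}$ are smooth, with $W(x,y)=W(y,x)$ for all $x,y$; $\beta>0$ is a constant; $(a)_+=\max\{a,0\}$. The spatial domain is discretized by a lattice graph with vertex set $\mathcal V=\{1,\dots,n\}$ and edge set $E$, corresponding to a uniform discretization of the domain with spacing $\Delta x$. It is a Cartesian product $G=G_1\Box\cdots\Box G_d$ of $d$ one-dimensional lattices. Each vertex $i$ represents a point $x(i)\in\mathbb{R}^d$, and $N(i)=\{j\in \mathcal V:(i,j)\in E\}$ is its adjacency set. The neighbours of $i$ in the $v$-th direction are the vertices at the points $x(i)\pm\Delta x\,e_v$, where $e_v$ is the $v$-th standard basis vector, $v=1,\dots,d$.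 The finite volume interpretation is that $\rho_i(t)$ stands for the cell mass $\int_{C_i}\rho(t,x)\,dx$, where $C_i$ is the cube of width $\Delta x$ centered at $x(i)$. The discrete free energy is $\mathcal{F}(\rho)=\sum_{i=1}^n v_i\rho_i+\frac12\sum_{i=1}^n\sum_{j=1}^n w_{ij}\rho_i\rho_j+\beta\sum_{i=1}^n\rho_i\log\rho_i$, with $v_i=V(x(i))$ and $w_{ij}=W(x(i),x(j))$, and $F_i(\rho)=\frac{\partial}{\partial\rho_i}\mathcal{F}(\rho)=v_i+\sum_{j=1}^n w_{ij}\rho_j+\beta\log\rho_i+\beta$.
   Formalization: Taken on all of R^d, for smooth positive solutions, with an added assumption: W and its x-derivatives up to order 2, sampled near y and weighted by ρ(t,y), are dominated by an integrable function, locally uniformly in x; without it the lattice sums of W can diverge. *)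

(* Defs.v *)
From HB Require Import structures.
From mathcomp Require Import all_boot all_order all_algebra.
From mathcomp Require Import all_classical all_reals all_analysis.
From mathcomp Require Import measurable_realfun.

Set Implicit Arguments.
Unset Strict Implicit.
Unset Printing Implicit Defensive.

Import Order.TTheory GRing.Theory Num.Theory.
Import numFieldNormedType.Exports.

Local Open Scope classical_set_scope.
Local Open Scope ring_scope.

(** Lebesgue measure on R^d.  The library equips tuples, not row vectors, with
    the product sigma-algebra, so the measure lives on tuples and integrands on
    row vectors are pulled back along [vec] below. *)
Fixpoint lebesgue_tuple (R : realType) (d : nat) :
    set (d.-tuple (measurableTypeR R)) -> \bar R :=
  match d with
  | 0%N => fun A => (\d_([tuple] : 0.-tuple (measurableTypeR R)) A)%E
  | d'.+1 => fun A => (\int[@lebesgue_measure R]_x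
      lebesgue_tuple [set y : d'.-tuple (measurableTypeR R) |
                      A [tuple of x :: y]])%E
  end.
Arguments lebesgue_tuple : clear implicits.

(** The library's instance for [\x] is shadowed by the one for products of
    probabilities. *)
Lemma sigma_finite_product d1 d2 (T1 : measurableType d1)
    (T2 : measurableType d2) (R : realType)
    (m1 : {sigma_finite_measure set T1 -> \bar R})
    (m2 : {sigma_finite_measure set T2 -> \bar R}) :
  sigma_finite setT (m1 \x m2)%E.
Proof.
have /sigma_finiteP[F [TF ndF Foo]] := sigma_finiteT m1.
have /sigma_finiteP[G [TG ndG Goo]] := sigma_finiteT m2.
exists (fun n => F n `*` G n).
  rewrite -setXTT TF TG predeqE => -[x y]; split.
    move=> [/= [n _ Fnx] [k _ Gky]]; exists (maxn n k) => //; split.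
    - by move: x Fnx; exact/subsetPset/ndF/leq_maxl.
    - by move: y Gky; exact/subsetPset/ndG/leq_maxr.
  by move=> [n _ []/= ? ?]; split; exists n.
move=> k; have [? ?] := Foo k; have [? ?] := Goo k.
split; first exact: measurableX.
by rewrite product_measure1E// lte_mul_pinfty// ge0_fin_numE.
Qed.

Section lebesgue_tuple_measure.
Variable R : realType.
Local Open Scope ereal_scope.

Let T := measurableTypeR R.

Let consp d (p : T * d.-tuple T) : d.+1.-tuple T := [tuple of p.1 :: p.2].

Let measurable_consp d : measurable_fun setT (@consp d).
Proof. exact: measurable_cons. Qed.

Let unconsp d (t : d.+1.-tuple T) : T * d.-tuple T :=
  (thead t, [tuple of behead t]).

Let measurable_unconsp d : measurable_fun setT (@unconsp d).
Proof.
apply: measurable_fun_pair; last exact: measurable_behead.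
exact: measurable_tnth.
Qed.

Let conspK d : cancel (@consp d) (@unconsp d).
Proof. by case=> x y; congr pair; exact/val_inj. Qed.

Let lebesgue_tupleS d :
  lebesgue_tuple R d.+1 =
  pushforward (@lebesgue_measure R \x lebesgue_tuple R d) (@consp d).
Proof.
apply/funext => A; rewrite /pushforward /product_measure1/=.
apply: eq_integral => x _; congr lebesgue_tuple.
by apply/seteqP; split => y /=; rewrite /xsection/= !inE.
Qed.

Section cons_measure.
Variables (d : nat) (m : {sigma_finite_measure set (d.-tuple T) -> \bar R}).

Definition cons_measure : set (d.+1.-tuple T) -> \bar R :=
  pushforward (@lebesgue_measure R \x m) (@consp d).

Let cons_measure0 : cons_measure set0 = 0.
Proof. by rewrite /cons_measure /pushforward preimage_set0 measure0. Qed.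

Let cons_measure_ge0 A : 0 <= cons_measure A.
Proof. by rewrite /cons_measure /pushforward measure_ge0. Qed.

Let cons_measure_sigma_additive : semi_sigma_additive cons_measure.
Proof.
move=> F mF tF mUF; rewrite /cons_measure /pushforward preimage_bigcup.
apply: measure_semi_sigma_additive.
- by move=> n; rewrite -[X in measurable X]setTI; exact: measurable_consp.
- apply/trivIsetP => /= i j _ _ ij; rewrite -preimage_setI.
  by move/trivIsetP : tF => /(_ _ _ _ _ ij) ->//; rewrite preimage_set0.
- by rewrite -preimage_bigcup -[X in measurable X]setTI; exact: measurable_consp.
Qed.

HB.instance Definition _ := isMeasure.Build _ _ _ cons_measure
  cons_measure0 cons_measure_ge0 cons_measure_sigma_additive.

Let cons_measure_sigma_finite : sigma_finite setT cons_measure.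
Proof.
have [F FT Fmu] := sigma_finite_product (@lebesgue_measure R) m.
exists (fun n => @unconsp d @^-1` F n).
  by rewrite -preimage_bigcup -FT preimage_setT.
move=> n; have [mF Foo] := Fmu n; split.
  by rewrite -[X in measurable X]setTI; exact: measurable_unconsp.
rewrite /cons_measure /pushforward -comp_preimage.
rewrite (_ : @unconsp d \o @consp d = id) //.
by apply/funext => p /=; rewrite conspK.
Qed.

HB.instance Definition _ := Measure_isSigmaFinite.Build _ _ _ cons_measure
  cons_measure_sigma_finite.

End cons_measure.

Lemma lebesgue_tuple_sigma_finite_measure d :
  exists m : {sigma_finite_measure set (d.-tuple T) -> \bar R},
    lebesgue_tuple R d = m.
Proof.
elim: d => [|d [m E]]; first by exists (\d_([tuple] : 0.-tuple T)).
by exists (cons_measure m); rewrite lebesgue_tupleS E.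
Qed.

Let lebesgue_tuple0 d : lebesgue_tuple R d set0 = 0.
Proof. by have [m ->] := lebesgue_tuple_sigma_finite_measure d. Qed.

Let lebesgue_tuple_ge0 d A : 0 <= lebesgue_tuple R d A.
Proof. by have [m ->] := lebesgue_tuple_sigma_finite_measure d. Qed.

Let lebesgue_tuple_sigma_additive d :
  semi_sigma_additive (lebesgue_tuple R d).
Proof.
have [m ->] := lebesgue_tuple_sigma_finite_measure d.
exact: measure_semi_sigma_additive.
Qed.

HB.instance Definition _ d := isMeasure.Build _ _ _ (lebesgue_tuple R d)
  (lebesgue_tuple0 d) (@lebesgue_tuple_ge0 d)
  (@lebesgue_tuple_sigma_additive d).

Let lebesgue_tuple_sigma_finite d : sigma_finite setT (lebesgue_tuple R d).
Proof.
by have [m ->] := lebesgue_tuple_sigma_finite_measure d; exact: sigma_finiteT.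
Qed.

HB.instance Definition _ d := Measure_isSigmaFinite.Build _ _ _
  (lebesgue_tuple R d) (@lebesgue_tuple_sigma_finite d).

Lemma lebesgue_tuple_box d (a b : 'I_d -> R) : (forall i, (a i <= b i)%R) ->
  lebesgue_tuple R d
    [set y | forall i, (a i <= tnth y i <= b i)%R] =
  (\prod_(i < d) (b i - a i)%R)%:E.
Proof.
elim: d a b => [|d IH] a b ab.
  by rewrite big_ord0 /= diracE mem_set//= => -[].
rewrite big_ord_recl /=.
pose Q := (\prod_(i < d) (b (lift ord0 i) - a (lift ord0 i)))%R.
transitivity (\int[@lebesgue_measure R]_x
    (Q%:E * (\1_(`[a ord0, b ord0]%classic : set R) x)%:E)).
  apply: eq_integral => x _; rewrite indicE.
  have [xab|xab] := boolP (x \in _).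
    rewrite mule1 -IH//; congr (lebesgue_tuple R d _); apply/seteqP.
    move: xab; rewrite inE/= in_itv/= => xab; split=> y /= H i.
      by have := H (lift ord0 i); rewrite tnthS.
    by case: (unliftP ord0 i) => [j ->|->]; rewrite ?tnthS.
  rewrite mule0 (_ : [set _ | _] = set0) ?measure0//.
  rewrite -subset0 => y /= /(_ ord0) H; move/negP: xab; apply.
  by rewrite inE/= in_itv/=.
rewrite ge0_integralZl//; last 2 first.
  by apply/measurable_EFinP; exact: measurable_indic.
  by rewrite lee_fin; apply: prodr_ge0 => i _; rewrite subr_ge0.
rewrite integral_indic// setIT.
rewrite (_ : _ `[a ord0, b ord0]%classic =
  @lebesgue_measure R [set` `[a ord0, b ord0]%R])//.
rewrite lebesgue_measure_itv/= lte_fin -/Q.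
have := ab ord0; rewrite le_eqVlt => /orP[/eqP ->|->].
  by rewrite ltxx mule0 subrr mul0r.
by rewrite -EFinD -EFinM mulrC.
Qed.

End lebesgue_tuple_measure.

Section consistency.
Variables (R : realType) (d : nat).
Local Notation E := 'rV[R]_d.

Definition vec (n : nat) (y : n.-tuple (measurableTypeR R)) : 'rV[R]_n :=
  \row_i tnth y i.

Definition integral_on (n : nat) (A : set 'rV[R]_n) (f : 'rV[R]_n -> R) : R :=
  \int[lebesgue_tuple R n]_(y in @vec n @^-1` A) f (vec y).

Definition integrable_on_space (f : E -> R) : Prop :=
  (lebesgue_tuple R d).-integrable setT (fun y => (f (vec y))%:E).

Definition basis_vec (v : 'I_d) : E := delta_mx 0 v.

Definition iter_derive (U : normedModType R) (s : seq U) (f : U -> R) :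
  U -> R := foldr (fun v g => 'D_v g) f s.

(** C^infinity on the open set [A]: all iterated directional derivatives exist
    and are continuous at every point of [A]. *)
Definition smooth_on (U : normedModType R) (A : set U) (f : U -> R) : Prop :=
  forall (s : seq U) x, A x ->
    {for x, continuous (iter_derive s f)} /\
    forall v, derivable (iter_derive s f) x v.

(** Box-shaped lattice: the Cartesian product of the [d] paths with
    [sides v] vertices, embedded in R^d. *)
Record lattice := Lattice {
  spacing : R ;
  spacing_gt0 : 0 < spacing ;
  origin : E ;
  sides : 'I_d -> nat }.

Definition vertex (L : lattice) : finType :=
  {dffun forall v : 'I_d, 'I_(sides L v)}.

Definition path_edge (n : nat) (a b : 'I_n) : bool :=
  (a.+1 == b :> nat) || (b.+1 == a :> nat).

Definition adjacent (L : lattice) (i j : vertex L) : bool :=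
  [exists v, path_edge (i v) (j v) && [forall (u | u != v), i u == j u]].

Definition successor (L : lattice) (v : 'I_d) (i j : vertex L) : bool :=
  ((i v).+1 == j v :> nat) && [forall (u | u != v), i u == j u].

Definition point (L : lattice) (i : vertex L) : E :=
  origin L + spacing L *: \row_v (i v)%:R.

Definition cell (L : lattice) (i : vertex L) : set E :=
  [set y | forall v, `|y 0 v - point i 0 v| <= spacing L / 2].

Definition cell_mass (L : lattice) (r : E -> R) (i : vertex L) : R :=
  integral_on (cell i) r.

Definition insert_coord (v : 'I_d) (c : R) (z : 'rV[R]_d.-1) : E :=
  \row_u (if unlift v u is Some u' then z 0 u' else c).

(** Surface integral over the face of [cell i] with outer normal
    [basis_vec v]. *)
Definition face_integral (L : lattice) (i : vertex L) (v : 'I_d)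
    (f : E -> R) : R :=
  integral_on
    [set z : 'rV[R]_d.-1 |
      forall u, `|z 0 u - point i 0 (lift v u)| <= spacing L / 2]
    (fun z => f (insert_coord v (point i 0 v + spacing L / 2) z)).

Definition scheme := forall L : lattice, (vertex L -> R) -> vertex L -> R.

Section equation.
Variables (V : E -> R) (W : E -> E -> R) (beta : R).

Definition free_energy (L : lattice) (m : vertex L -> R) : R :=
  \sum_i V (point i) * m i +
  2^-1 * \sum_i \sum_j W (point i) (point j) * m i * m j +
  beta * \sum_i m i * ln (m i).

Definition energy_gradient (L : lattice) (m : vertex L -> R)
    (i : vertex L) : R :=
  derive1 (fun s => free_energy (fun j => if j == i then s else m j)) (m i).

Definition fokker_planck_scheme : scheme := fun L m i =>
  let F := energy_gradient m in
  (spacing L ^+ 2)^-1 *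
  (\sum_(j | adjacent i j) m j * Num.max (F j - F i) 0 -
   \sum_(j | adjacent i j) m i * Num.max (F i - F j) 0).

Definition potential (r : E -> R) (x : E) : R :=
  V x + integral_on setT (fun y => W x y * r y).

Definition drift_component (r : E -> R) (v : 'I_d) (x : E) : R :=
  r x * 'D_(basis_vec v) (potential r) x.

Definition laplacian (r : E -> R) (x : E) : R :=
  \sum_v 'D_(basis_vec v) ('D_(basis_vec v) r) x.

(** The equation reads [d rho / dt + div current = 0]. *)
Definition current (r : E -> R) (v : 'I_d) (x : E) : R :=
  - (drift_component r v x + beta * 'D_(basis_vec v) r x).

(** Positivity is part of the notion of solution because the scheme involves
    the logarithms of the cell masses. *)
Record classical_solution (T : R) (rho : R -> E -> R) : Prop := {
  solution_smooth : smooth_on [set p : R^o * E | 0 < p.1 < T]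
    (fun p => rho p.1 p.2) ;
  solution_gt0 : forall t x, 0 < t < T -> 0 < rho t x ;
  solution_density : forall t, 0 < t < T ->
    integrable_on_space (rho t) /\ integral_on setT (rho t) = 1 ;
  solution_equation : forall t x, 0 < t < T ->
    derive1 (fun s => rho s x) t =
      \sum_v 'D_(basis_vec v) (drift_component (rho t) v) x +
      beta * laplacian (rho t) x }.

(** Since R^d is unbounded, smoothness of [W] does not make
    [int W(x,y) rho(t,y) dy] finite, twice differentiable under the integral
    sign, or approximable by sampling [W] at lattice points.  This is the
    corresponding domination hypothesis, locally uniform in [x].  For
    [a = b] it holds for every density [rho a] when [W] and its [x]-derivatives
    up to order two are bounded. *)
Definition dominated_interaction (rho : R -> E -> R) (a b : R) : Prop :=
  forall r : R, exists g : E -> R, exists2 delta : R, 0 < delta &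
    integrable_on_space g /\
    forall (s : seq 'I_d) t x y z, (size s <= 2)%N ->
      a <= t <= b -> `|x| <= r -> `|z - y| <= delta ->
      `|iter_derive [seq basis_vec v | v <- s] (W ^~ z) x| * rho t y <= g y.

(** A lattice has finitely many vertices, so R^d is discretized by boxes that
    eventually cover every bounded set. *)
Definition refining (L : nat -> lattice) : Prop :=
  spacing (L k) @[k --> \oo] --> 0 /\
  forall r : R, \forall k \near \oo,
    forall y : E, `|y| <= r -> exists i : vertex (L k), cell i y.

(** [S] is in conservation form, with antisymmetric numerical fluxes [flux]
    ([flux L m i j] being the rate of mass transfer from cell [i] to cell [j]);
    and for the cell masses of an exact solution, as the spacing tends to [0]
    and locally uniformly in space and time,
    - the numerical flux through a face, divided by the area of the face,
      agrees with the exact flux of the equation up to [o(1)];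
    - the residual of the scheme, divided by the volume of the cell,
      is [o(1)]. *)
Definition consistent_finite_volume (S : scheme) : Prop :=
  exists flux : forall L : lattice,
      (vertex L -> R) -> vertex L -> vertex L -> R,
  [/\ forall L m (i j : vertex L), adjacent i j ->
        flux L m i j = - flux L m j i,
      forall L m (i : vertex L),
        S L m i = - \sum_(j | adjacent i j) flux L m i j &
      forall (T : R) (rho : R -> E -> R) (a b : R) (L : nat -> lattice),
        classical_solution T rho ->
        0 < a -> a <= b -> b < T -> dominated_interaction rho a b ->
        refining L ->
        forall r eps : R, 0 < eps -> \forall k \near \oo,
        forall (t : R) (i : vertex (L k)), a <= t <= b -> `|point i| <= r ->
          let h := spacing (L k) in
          let m s := @cell_mass (L k) (rho s) in
          (forall (v : 'I_d) (j : vertex (L k)), successor v i j ->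
             `|flux (L k) (m t) i j -
               face_integral i v (current (rho t) v)| <= eps * h ^+ d.-1) /\
          `|derive1 (fun s => m s i) t - S (L k) (m t) i| <= eps * h ^+ d].

End equation.

End consistency.

(* Main.v *)
Require Import Defs.
From mathcomp Require Import all_boot all_order all_algebra.
From mathcomp Require Import all_classical all_reals all_analysis.
From mathcomp Require Import measurable_realfun.
From mathcomp Require Import ring lra zify.

(** A finite volume scheme is consistent when its numerical flux and its
    balance agree with the exact ones for the cell masses of an exact solution,
    up to lower order terms.  Both claims are statements about limits.

    Write [A] for the cell averages of the solution, that is the cell masses
    divided by [h ^+ d], and [F] for the discrete energy gradient.  Up to an
    additive constant, [F] is the discrete potential plus [beta * ln A].  The
    numerical flux across a face, from a cell to its successor in direction
    [v], is [- h ^+ (d - 2)] times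
      [(A0 + A1) / 2 * (F1 - F0) + (A1 - A0) / 2 * |F1 - F0|]
    ([upwindE]).  After division by the area [h ^+ (d - 1)] its first term
    tends to [rho] times the derivative of the potential plus [beta * ln rho],
    whose opposite is the exact current, and the second one, an upwind
    viscosity, is of order [h].  Taking the difference over two opposite faces
    gains one more order: the centred terms produce a second difference
    quotient of [F] and a product of first difference quotients
    ([balance_split]), while the two viscosities, which have the same limit,
    cancel.  The limit is
      [rho * phi'' + rho' * phi'], with [phi] the potential plus [beta * ln rho],
    summed over the directions, and this is the right-hand side of the equation
    because the logarithmic terms collapse to [beta * rho''] ([balance_limit]).

    It remains to see that first and second difference quotients of [A], of [ln
    A] and of the discrete potential converge to derivatives.
    - For [A], translation invariance of Lebesgue measure turns a difference
      quotient of averages into an average of difference quotients of [rho],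
      which are close to derivatives by the mean value theorem
      ([average_quotient_cvg],
      [average_second_cvg]).  Logarithms follow ([ln_quotient_cvg],
      [ln_second_cvg]).
    - The interaction part of the discrete potential is a sum over the lattice.
      It is the integral of a step function that samples [W] at the centres of
      the half-open cells, so dominated convergence applies
      ([lattice_sum_cvg]); the difference quotients of [W] are values of its
      derivatives at nearby points and obey the same domination
      ([quotient_kernel_limit]). The derivatives of the exact potential come
      from the same convergence lemma ([interaction_derive]).

    All limits are taken along one sequence of lattices, times and vertices
    that converge to a time and a point ([flux_consistent],
    [scheme_consistent]). Compactness of bounded closed sets then yields local
    uniformity in space and time ([sequential_to_uniform]). *)

Set Implicit Arguments.
Unset Strict Implicit.
Unset Printing Implicit Defensive.

Import Order.TTheory GRing.Theory Num.Theory.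
Import numFieldNormedType.Exports.

Local Open Scope classical_set_scope.
Local Open Scope ring_scope.

Local Notation point := Defs.point.
Local Notation adjacent := Defs.adjacent.

(** * Difference quotients along a line *)

Section difference_quotients.
Context {R : realType} {U : normedModType R}.
Implicit Types (f : U -> R) (p q v : U).

Lemma is_derive_line f p v (s : R) : derivable f (p + s *: v) v ->
  is_derive s 1 (fun x : R => f (p + x *: v)) ('D_v f (p + s *: v)).
Proof.
move=> df.
have E : (fun h : R => h^-1 *:
  (((fun x : R => f (p + x *: v)) \o shift s) (h *: 1)
    - f (p + s *: v))) =
  (fun h => h^-1 *: ((f \o shift (p + s *: v)) (h *: v) - f (p + s *: v))).
  apply/funext => h /=; congr (_ *: (f _ - _)).
  by rewrite [h *: 1]mulr1 scalerDl addrCA.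
by split; rewrite /derivable /derive E.
Qed.

(** The step [h] may be negative, because a vertex has neighbours on both sides
    in each direction. *)
Lemma mean_value_line f p v (h : R) :
  (forall s : R, `|s| <= `|h| -> derivable f (p + s *: v) v) ->
  exists2 s : R, `|s| <= `|h| & f (p + h *: v) - f p = h * 'D_v f (p + s *: v).
Proof.
move=> df; pose phi (x : R) := f (p + x *: v).
have dphi (s : R) : `|s| <= `|h| ->
    is_derive s 1 phi ('D_v f (p + s *: v)).
  by move=> sh; apply: is_derive_line; exact: df.
have cphi (s : R) : `|s| <= `|h| -> {for s, continuous phi}.
  move=> /dphi [D _]; apply: differentiable_continuous.
  exact/derivable1_diffP.
have phi0 : phi 0 = f p by rewrite /phi scale0r addr0.
have [h0|h0] := leP 0 h.
- have le x : x \in `[0, h] -> `|x| <= `|h|.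
    by rewrite in_itv/= => /andP[x0 xh]; rewrite !ger0_norm.
  have [|s|s sh] := @MVT_segment R phi (fun s => 'D_v f (p + s *: v)) 0 h h0.
  + by move=> s sh; apply/dphi/le; exact: subset_itv_oo_cc.
  + apply: continuous_in_subspaceT => x; rewrite inE => xh.
    exact/cphi/le.
  + rewrite subr0 phi0 => E; exists s; first exact: le.
    by rewrite [LHS]E mulrC.
- have le x : x \in `[h, 0] -> `|x| <= `|h|.
    by rewrite in_itv/= => /andP[x0 xh]; rewrite !ler0_norm// ?lerN2// ltW.
  have [|s|s sh] := @MVT_segment R phi (fun s => 'D_v f (p + s *: v)) h 0
    (ltW h0).
  + by move=> s sh; apply/dphi/le; exact: subset_itv_oo_cc.
  + apply: continuous_in_subspaceT => x; rewrite inE => xh.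
    exact/cphi/le.
  + rewrite sub0r phi0 => E; exists s; first exact: le.
    by rewrite -opprB -/(phi h) E mulrN opprK mulrC.
Qed.

(** The mean value theorem is applied twice: to the increment [f (q + h v) - f
    q] between [p - h v] and [p], and then to the derivative of [f]. The crude
    bound [3 |h|] on the intermediate point is the sum of the three
    displacements this produces. *)
Lemma second_mean_value_line f p v (h : R) :
  (forall s : R, `|s| <= 3 * `|h| ->
    derivable f (p + s *: v) v /\ derivable ('D_v f) (p + s *: v) v) ->
  exists2 s : R, `|s| <= 3 * `|h| &
    f (p + h *: v) - 2 * f p + f (p - h *: v) =
    h ^+ 2 * 'D_v ('D_v f) (p + s *: v).
Proof.
move=> df; pose g q := f (q + h *: v) - f q.
have dg q : derivable f (q + h *: v) v -> derivable f q v ->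
    is_derive q v g ('D_v f (q + h *: v) - 'D_v f q).
  move=> d1 d2.
  have ? : is_derive q v (fun q => f (q + h *: v)) ('D_v f (q + h *: v)).
    have E : (fun k : R => k^-1 *:
      (((fun q => f (q + h *: v)) \o shift q) (k *: v)
        - f (q + h *: v))) =
      (fun k => k^-1 *: ((f \o shift (q + h *: v)) (k *: v) - f (q + h *: v))).
      by apply/funext => k /=; rewrite -addrA.
    by split; rewrite /derivable /derive E.
  have ? : is_derive q v f ('D_v f q) by split.
  exact: is_deriveB.
have pE s : p - h *: v + s *: v = p + (s - h) *: v.
  by rewrite scalerBl addrAC -addrA.
have pE' s : p - h *: v + s *: v + h *: v = p + s *: v.
  by rewrite pE -addrA -scalerDl subrK.
have n0 : 0 <= `|h| by [].
have [s sh|s sh] := @mean_value_line g (p - h *: v) v h.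
  apply: (@ex_derive _ _ _ _ _ _ _ (dg _ _ _)).
    rewrite pE'; apply: (fun H => proj1 (df _ H)); lra.
  rewrite pE; apply: (fun H => proj1 (df _ H)).
  by rewrite (le_trans (ler_normB _ _))//; lra.
rewrite /g subrK => E.
have := dg (p - h *: v + s *: v) => /(_ _ _)/(@derive_val _ _ _ _ _ _ _) D.
move: E; rewrite D; last 2 first.
- rewrite pE'; apply: (fun H => proj1 (df _ H)); lra.
- rewrite pE; apply: (fun H => proj1 (df _ H)).
  by rewrite (le_trans (ler_normB _ _))//; lra.
have [u uh|u uh] := @mean_value_line ('D_v f) (p - h *: v + s *: v) v h.
  rewrite pE -addrA -scalerDl; apply: (fun H => proj2 (df _ H)).
  rewrite (le_trans (ler_normD _ _))//
    (le_trans (lerD (ler_normB _ _) (lexx _)))//; lra.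
move=> ->; rewrite pE -(addrA p ((s - h) *: v)) -scalerDl => E.
exists (s - h + u); last by rewrite expr2 -mulrA -E; ring.
rewrite (le_trans (ler_normD _ _))//
  (le_trans (lerD (ler_normB _ _) (lexx _)))//; lra.
Qed.

(** The quotient is a value of the directional derivative at a nearby point, so
    the continuity of the derivative makes the approximation uniform in the
    base point. *)
Lemma difference_quotient_near f p v :
  (\forall q \near p, derivable f q v) -> {for p, continuous ('D_v f)} ->
  forall eps : R, 0 < eps -> exists2 del : R, 0 < del &
    forall q h, `|q - p| < del -> `|h| < del -> h != 0 ->
      `|(f (q + h *: v) - f q) / h - 'D_v f p| <= eps.
Proof.
move=> df cf.
pose P q := derivable f q v; have {}df : nbhs p P := df.
pose D : U -> R := 'D_v f; have {}cf : {for p, continuous D} := cf.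
have MV q h : (forall s : R, `|s| <= `|h| -> P (q + s *: v)) ->
  exists2 s : R, `|s| <= `|h| &
    f (q + h *: v) - f q = h * D (q + s *: v) by exact: mean_value_line.
move=> eps eps0; change ('D_v f p) with (D p); clearbody D P.
have /cvgrPdist_le /(_ _ eps0) cf' := cf.
have /nbhs_ballP[e /= e0 He] :
  nbhs p (P `&` [set q | `|D p - D q| <= eps]) by exact: filterI df cf'.
have nv : 0 < `|v| + 1 by rewrite ltr_wpDl.
exists (e / 2 / (`|v| + 1)); first by rewrite !divr_gt0.
move=> q h qp hd h0.
have step s : `|s| <= `|h| -> P (q + s *: v) /\
    `|D p - D (q + s *: v)| <= eps.
  move=> sh; apply: He; rewrite -ball_normE/= opprD addrA.
  rewrite (le_lt_trans (ler_normB _ _))// distrC normrZ.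
  have : `|q - p| < e / 2.
    rewrite (lt_le_trans qp)// ler_pdivrMr// ler_peMr//;
      first by rewrite divr_ge0// ltW.
    by rewrite lerDr.
  have : `|s| * `|v| <= e / 2.
    rewrite (@le_trans _ _ (e / 2 / (`|v| + 1) * (`|v| + 1)))//.
      by rewrite ler_pM// ?lerDl// (le_trans sh)// ltW.
    by rewrite divfK// gt_eqF.
  by rewrite [in X in _ -> _ -> X](splitr e); lra.
have [s sh|s sh ->] := MV q h; first by have [] := step s sh.
have [_ D_le] := step s sh.
by rewrite mulrAC divff// mul1r distrC.
Qed.

Lemma second_difference_near f p v :
  (\forall q \near p, derivable f q v) ->
  (\forall q \near p, derivable ('D_v f) q v) ->
  {for p, continuous ('D_v ('D_v f))} ->
  forall eps : R, 0 < eps -> exists2 del : R, 0 < del &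
    forall q h, `|q - p| < del -> `|h| < del -> h != 0 ->
      `|(f (q + h *: v) - 2 * f q + f (q - h *: v)) / h ^+ 2 -
        'D_v ('D_v f) p| <= eps.
Proof.
move=> df df2 cf.
pose P q := derivable f q v; have {}df : nbhs p P := df.
pose P' q := derivable ('D_v f) q v; have {}df2 : nbhs p P' := df2.
pose D : U -> R := 'D_v ('D_v f); have {}cf : {for p, continuous D} := cf.
have MV q h : (forall s : R, `|s| <= 3 * `|h| ->
    P (q + s *: v) /\ P' (q + s *: v)) ->
  exists2 s : R, `|s| <= 3 * `|h| &
    f (q + h *: v) - 2 * f q + f (q - h *: v) =
    h ^+ 2 * D (q + s *: v) by exact: second_mean_value_line.
move=> eps eps0; change ('D_v ('D_v f) p) with (D p); clearbody D P P'.
have /cvgrPdist_le /(_ _ eps0) cf' := cf.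
have /nbhs_ballP[e /= e0 He] :
    nbhs p (P `&` P' `&` [set q | `|D p - D q| <= eps]).
  by apply: filterI cf'; exact: filterI.
have nv : 0 < 3 * (`|v| + 1) by rewrite mulr_gt0// ltr_wpDl.
exists (e / 2 / (3 * (`|v| + 1))); first by rewrite !divr_gt0.
move=> q h qp hd h0.
have step s : `|s| <= 3 * `|h| -> (P (q + s *: v) /\ P' (q + s *: v)) /\
    `|D p - D (q + s *: v)| <= eps.
  move=> sh; apply: He; rewrite -ball_normE/= opprD addrA.
  rewrite (le_lt_trans (ler_normB _ _))// distrC normrZ.
  have : `|q - p| < e / 2.
    rewrite (lt_le_trans qp)// ler_pdivrMr// ler_peMr//;
      first by rewrite divr_ge0// ltW.
    by have : 0 <= `|v| by []; lra.
  have : `|s| * `|v| <= e / 2.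
    rewrite (@le_trans _ _ (e / 2 / (3 * (`|v| + 1)) * (3 * (`|v| + 1))))//.
      rewrite [leRHS]mulrA ler_pM// ?lerDl// (le_trans sh)// mulrC.
      by rewrite ler_pM2r// ltW.
    by rewrite divfK// gt_eqF.
  by rewrite [in X in _ -> _ -> X](splitr e); lra.
have [s sh|s sh ->] := MV q h; first by have [] := step s sh.
have [_ D_le] := step s sh.
by rewrite mulrAC divff ?expf_neq0// mul1r distrC.
Qed.

End difference_quotients.

(** * Borel measurability and translation invariance *)

Section tuple_space.
Context {R : realType}.
Local Notation T := (measurableTypeR R).

Lemma rV_normP (n : nat) (x : 'rV[R]_n) (e : R) : 0 <= e ->
  (`|x| <= e) <-> (forall v, `|x 0 v| <= e).
Proof.
move=> e0; rewrite [leLHS]/Num.Def.normr /= mx_normrE; split.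
  by move=> /bigmax_leP[_ H] v; exact: (H (0, v)).
by move=> H; apply/bigmax_leP; split=> // -[i j] _ /=; rewrite ord1.
Qed.

(** The sigma-algebra of tuples is generated by coordinates; an open set
    belongs to it because it is a countable union of boxes with rational
    centres and radii [1 / (k + 1)]. *)
Lemma measurable_vec_open (n : nat) (U : set 'rV[R]_n) :
  open U -> measurable (@vec R n @^-1` U).
Proof.
move=> oU.
pose B (c : n.-tuple rat * nat) : set (n.-tuple T) :=
  [set y | forall i, `|tnth y i - ratr (tnth c.1 i)| < c.2.+1%:R^-1].
have mB c : measurable (B c).
  rewrite (_ : B c = \bigcap_(i in [set: 'I_n])
      ((fun y : n.-tuple T => tnth y i) @^-1`
        (ball (ratr (tnth c.1 i) : R) c.2.+1%:R^-1))).
    apply: fin_bigcap_measurable => // i _.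
    rewrite -[X in measurable X]setTI; apply: measurable_tnth => //.
    exact: measurable_ball.
  apply/seteqP; split=> y /= H i.
    by move=> _; rewrite /ball/= distrC; exact: H.
  by have := H i Logic.I; rewrite /ball/= distrC.
rewrite (_ : _ @^-1` _ = \bigcup_(c in
  [set c | B c `<=` @vec R n @^-1` U]) B c);
    last first.
  apply/seteqP; split=> [y Uy|y [c /= cU cy]]; last exact: cU.
  have [e /= e0 He] : exists2 e : R, 0 < e & forall z : 'rV[R]_n,
      (forall i, `|tnth y i - z 0 i| < e) -> U z.
    have /nbhs_ballP[e /= e0 He] := open_nbhs_nbhs (conj oU Uy).
    exists e => // z Hz; apply: He; split=> // i j.
    by rewrite ord1 /ball/= mxE; exact: Hz.
  have [k Hk] : exists k, k.+1%:R^-1 < e / 2.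
    have e2 : 0 < e / 2 by rewrite divr_gt0.
    exists (Num.bound (e / 2)^-1); rewrite invf_plt ?posrE//.
    rewrite (lt_le_trans (archi_boundP _)) ?ler_nat//.
    by rewrite invr_ge0 ltW.
  have Hq i : exists q : rat, `|tnth y i - ratr q| < k.+1%:R^-1.
    have /rat_in_itvoo[q] : tnth y i - k.+1%:R^-1 < tnth y i + k.+1%:R^-1 :> R.
      by rewrite ltrD2l gtrN// invr_gt0.
    by rewrite in_itv/= => qi; exists q; rewrite ltr_distlC.
  have [q qP] := choice Hq.
  exists ([tuple q i | i < n], k); last by move=> i /=; rewrite tnth_mktuple.
  move=> z /= Hz; apply: He => i; rewrite mxE.
  have := Hz i; rewrite tnth_mktuple => zq.
  have := qP i => yq.
  rewrite (le_lt_trans (ler_distD (ratr (q i)) _ _))// [ltRHS]splitr ltrD//.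
    exact: lt_trans Hk.
  by rewrite distrC; exact: lt_trans Hk.
rewrite bigcup_mkcond; apply: countable_bigcupT_measurable => // c.
by case: ifPn.
Qed.

Lemma measurable_vec_continuous (n : nat) (f : 'rV[R]_n -> R) :
  continuous f -> measurable_fun [set: n.-tuple T] (f \o @vec R n).
Proof.
move=> /continuousP cf; apply: (measurability _ (RGenOpens.measurableE R)).
move=> _ [_ [a [b ->] <-]]; rewrite setTI comp_preimage.
apply: measurable_vec_open; apply: cf; exact: interval_open.
Qed.

Definition shift_tuple (n : nat) (a : 'I_n -> R) (y : n.-tuple T) :
  n.-tuple T :=
  [tuple tnth y i + a i | i < n].

Lemma measurable_shift (a : R) :
  measurable_fun [set: T] (fun x : T => x + a : T).
Proof. exact: measurable_funD. Qed.

Lemma measurable_shift_tuple (n : nat) (a : 'I_n -> R) :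
  measurable_fun setT (shift_tuple a).
Proof.
apply/measurable_fun_tnthP => i.
rewrite (_ : _ \o _ = fun y : n.-tuple T => tnth y i + a i); last first.
  by apply/funext => y /=; rewrite tnth_mktuple.
by apply: measurable_funD => //; exact: measurable_tnth.
Qed.

Lemma lebesgue_measure_shift (a : R) (A : set T) : measurable A ->
  lebesgue_measure ((fun x : T => x + a : T) @^-1` A) = lebesgue_measure A.
Proof.
move=> mA.
have mphi := measurable_shift a.
pose m := pushforward (@lebesgue_measure R) (fun x : T => x + a : T).
rewrite -[LHS]/(m A); apply/esym.
apply: (@lebesgue_measure_unique R
  [the measure _ _ of pushforward (@lebesgue_measure R)
    (fun x : T => x + a : T)])
  => //= _ [[u v]] _ <-.
rewrite /pushforward.
rewrite (_ : _ @^-1` _ = `]u - a, v - a]%classic); last first.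
  by apply/seteqP; split => x /=; rewrite !in_itv/= ltrBlDr lerBrDr.
rewrite !lebesgue_measure_itv/= !lte_fin ltrD2r -!EFinD.
by rewrite opprB addrA subrK.
Qed.

(** Induction on the dimension: the measure is an iterated integral, so the
    claim reduces to the invariance of its sections and to a translation of the
    outer, one-dimensional integral. *)
Lemma lebesgue_tuple_shift (n : nat) (a : 'I_n -> R) (A : set (n.-tuple T)) :
  measurable A -> lebesgue_tuple R n (shift_tuple a @^-1` A) =
    lebesgue_tuple R n A.
Proof.
elim: n a A => [|n IH] a A mA.
  congr (lebesgue_tuple R 0 _); apply/seteqP; split=> y /=;
  by rewrite !(tuple0 (shift_tuple _ _)) !(tuple0 y).
have mc : measurable_fun setT (fun p : T * n.-tuple T => [tuple of p.1 :: p.2]).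
  exact: measurable_cons.
pose A' := (fun p : T * n.-tuple T => [tuple of p.1 :: p.2]) @^-1` A.
have mA' : measurable A' by rewrite -[X in measurable X]setTI; exact: mc.
pose G (x : T) := lebesgue_tuple R n (xsection A' x).
have GE x : lebesgue_tuple R n [set y : n.-tuple T | A [tuple of x :: y]] = G x.
  congr (lebesgue_tuple R n _).
  by apply/seteqP; split => y /=; rewrite /xsection/= inE.
have mG : measurable_fun setT G by exact: measurable_fun_xsection.
rewrite /=; under [RHS]eq_integral do rewrite GE.
transitivity (\int[@lebesgue_measure R]_x (G (x + a ord0)%R))%E.
  apply: eq_integral => x _.
  rewrite /G -[RHS](IH (a \o lift ord0)); last exact: measurable_xsection.
  congr (lebesgue_tuple R n _).
  apply/seteqP; split => y /=; rewrite /xsection/= inE /A'/=.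
    congr (A _); apply/eq_from_tnth => i.
    case: (unliftP ord0 i) => [j ->|->];
      by rewrite ?tnthS !tnth_mktuple ?tnthS.
  congr (A _); apply/eq_from_tnth => i.
  case: (unliftP ord0 i) => [j ->|->];
    by rewrite ?tnthS !tnth_mktuple ?tnthS.
rewrite -(ge0_integral_pushforward (measurable_shift (a ord0)) _ measurableT
  mG)//.
apply: eq_measure_integral => /= [|? B mB _]; first exact: measurable_shift.
exact: lebesgue_measure_shift.
Qed.

End tuple_space.

(** * Integrals over cubes *)

Section cubes.
Context {R : realType}.
Local Notation T := (measurableTypeR R).
Local Notation mu := (lebesgue_tuple R).

Lemma continuous_addr (U : normedModType R) (a : U) :
  continuous (fun z : U => z + a).
Proof. by move=> z; apply: cvgD; [exact: cvg_id|exact: cvg_cst]. Qed.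

(** The cells of a lattice and, one dimension lower, their faces are cubes. *)
Definition cube (n : nat) (c : 'rV[R]_n) (h : R) : set 'rV[R]_n :=
  [set y | forall v, `|y 0 v - c 0 v| <= h / 2].

Lemma cube_norm (n : nat) (c : 'rV[R]_n) (h : R) z : 0 <= h -> cube c h z ->
  `|z - c| <= h / 2.
Proof.
move=> h0 cz; apply/rV_normP; first by rewrite divr_ge0.
by move=> v; rewrite !mxE; exact: cz.
Qed.

Lemma vec_cube (n : nat) (c : 'rV[R]_n) (h : R) :
  @vec R n @^-1` cube c h =
  [set y | forall i, c 0 i - h / 2 <= tnth y i <= c 0 i + h / 2].
Proof.
by apply/seteqP; split=> y /= H i; have := H i; rewrite mxE ler_distl.
Qed.

Lemma measurable_cube (n : nat) (c : 'rV[R]_n) (h : R) :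
  measurable (@vec R n @^-1` cube c h : set (n.-tuple T)).
Proof.
rewrite (_ : _ @^-1` _ = \bigcap_(i in [set: 'I_n])
  ((fun y : n.-tuple T => tnth y i) @^-1`
    `[c 0 i - h / 2, c 0 i + h / 2]%classic)).
  apply: fin_bigcap_measurable => // i _.
  by rewrite -[X in measurable X]setTI; apply: measurable_tnth.
rewrite vec_cube; apply/seteqP; split=> y /= H i.
  by move=> _ /=; rewrite in_itv/=; exact: H.
by have := H i Logic.I; rewrite /= in_itv.
Qed.

Lemma lebesgue_cube (n : nat) (c : 'rV[R]_n) (h : R) : 0 <= h ->
  mu n (@vec R n @^-1` cube c h) = (h ^+ n)%:E.
Proof.
move=> h0; rewrite vec_cube lebesgue_tuple_box; last first.
  by move=> i; rewrite lerD2l; lra.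
have E i : c 0 i + h / 2 - (c 0 i - h / 2) = h by lra.
under eq_bigr do rewrite E.
by rewrite prodr_const card_ord.
Qed.

Lemma compact_cube (n : nat) (c : 'rV[R]_n) (h : R) : compact (cube c h).
Proof.
rewrite (_ : cube c h = [set z : 'rV[R]_n | forall i,
    `[c 0 i - h / 2, c 0 i + h / 2]%classic (z ord0 i)]).
  apply: (@rV_compact _ _ (fun
    i => `[c 0 i - h / 2, c 0 i + h / 2]%classic)) => i.
  exact: segment_compact.
by apply/seteqP; split=> y /= H i; have := H i; rewrite /= ?in_itv/= ler_distl.
Qed.

Lemma integrable_cube (n : nat) (f : 'rV[R]_n -> R) (c : 'rV[R]_n) (h : R) :
  0 <= h -> continuous f ->
  (mu n).-integrable (@vec R n @^-1` cube c h) (EFin \o (f \o @vec R n)).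
Proof.
move=> h0 cf; apply: measurable_bounded_integrable.
- exact: measurable_cube.
- by rewrite [X in (X < _)%E](lebesgue_cube c h0) ltry.
- by apply: measurable_funTS; exact: measurable_vec_continuous.
- have /compact_bounded[M [Mr HM]] : compact (f @` cube c h).
    by apply: continuous_compact;
      [exact: continuous_subspaceT|exact: compact_cube].
  exists M; split=> // x /HM Hx y /= cy; apply: Hx.
  by exists (vec y).
Qed.

(** This is how pointwise estimates become estimates of cell and face
    integrals: an average over a cube inherits every bound valid on the whole
    cube. *)
Lemma cube_integral_near (n : nat) (f : 'rV[R]_n -> R) (c : 'rV[R]_n)
    (h l eps : R) : 0 <= h -> continuous f ->
  (forall z, cube c h z -> `|f z - l| <= eps) ->
  `|integral_on (cube c h) f - l * h ^+ n| <= eps * h ^+ n.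
Proof.
move=> h0 cf fl.
have icst k : (mu n).-integrable (@vec R n @^-1` cube c h) (EFin \o cst k).
  by apply: (@integrable_cube n (cst k)) => //; exact: cst_continuous.
have iff := integrable_cube c h0 cf.
have cstE k : \int[mu n]_(y in @vec R n @^-1` cube c h) k = k * h ^+ n.
  rewrite Rintegral_cst; last exact: measurable_cube.
  by rewrite [X in fine X](lebesgue_cube c h0).
have mC := measurable_cube c h.
rewrite /integral_on -(cstE l) -RintegralB//; last exact: icst.
have iB : (mu n).-integrable (@vec R n @^-1` cube c h)
    (EFin \o (fun y => f (vec y) - l)).
  rewrite (_ : _ \o _ = (EFin \o (f \o @vec R n)) \- (EFin \o cst l))%E //.
  by apply: integrableB => //; exact: icst.
rewrite (le_trans (le_normr_Rintegral mC iB))//.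
rewrite -cstE; apply: le_Rintegral => //.
- exact: (integrable_norm iB).
- exact: (icst eps).
- by move=> y cy; exact: fl.
Qed.

(** Translating the cell amounts to translating the integrand, which turns
    differences of neighbouring cell masses into integrals of differences of
    the density over one and the same cell. *)
Lemma integral_on_shift (n : nat) (f : 'rV[R]_n -> R) (c a : 'rV[R]_n)
    (h : R) : 0 <= h -> continuous f ->
  integral_on (cube (c + a) h) f = integral_on (cube c h) (fun z => f (z + a)).
Proof.
move=> h0 cf; rewrite /integral_on /Rintegral; congr fine.
have mf : measurable_fun setT (EFin \o (f \o @vec R n)).
  by apply/measurable_EFinP; exact: measurable_vec_continuous.
have mS := measurable_shift_tuple (fun i => a 0 i).
have vS y : vec (shift_tuple (fun i => a 0 i) y) = vec y + a.
  by apply/rowP => i; rewrite !mxE tnth_mktuple.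
have pre : shift_tuple (fun i => a 0 i) @^-1` (@vec R n @^-1` cube (c + a) h) =
    @vec R n @^-1` cube c h.
  apply/seteqP; split=> y /= H i; have := H i; rewrite vS !mxE;
    by rewrite opprD addrACA subrr addr0.
transitivity (\int[pushforward (mu n) (shift_tuple (fun i => a ord0 i))]_(y in
   @vec R n @^-1` cube (c + a) h) (f (vec y))%:E)%E.
  apply: eq_measure_integral => /= A mA _.
  by rewrite /pushforward lebesgue_tuple_shift.
rewrite (integral_pushforward mS mf)//; last exact: measurable_cube.
- by rewrite pre; apply: eq_integral => y _ /=; rewrite vS.
- rewrite pre.
  rewrite (_ : (_ \o _) \o _ = EFin \o ((f \o (fun z => z + a)) \o @vec R n)).
    apply: (@integrable_cube n (f \o (fun z => z + a)) c h h0) => z;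
      apply: continuous_comp; last exact: cf.
    exact: continuous_addr.
  by apply/funext => y /=; rewrite vS.
Qed.

Lemma integral_on_cubeD (n : nat) (f g : 'rV[R]_n -> R) (c : 'rV[R]_n)
    (h : R) : 0 <= h -> continuous f -> continuous g ->
  integral_on (cube c h) (fun z => f z + g z) =
  integral_on (cube c h) f + integral_on (cube c h) g.
Proof.
move=> h0 cf cg; rewrite /integral_on RintegralD//.
- exact: measurable_cube.
- exact: integrable_cube.
- exact: integrable_cube.
Qed.

Lemma integral_on_cubeZ (n : nat) (k : R) (f : 'rV[R]_n -> R) (c : 'rV[R]_n)
    (h : R) : 0 <= h -> continuous f ->
  integral_on (cube c h) (fun z => k * f z) = k * integral_on (cube c h) f.
Proof.
move=> h0 cf; rewrite /integral_on RintegralZl//.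
- exact: measurable_cube.
- exact: integrable_cube.
Qed.

End cubes.

(** * Dominated convergence and half-open cubes *)

Section dominated.
Context {R : realType}.
Local Notation T := (measurableTypeR R).
Local Notation mu := (lebesgue_tuple R).

Definition measurable_rV (n : nat) (f : 'rV[R]_n -> R) :=
  measurable_fun setT (f \o @vec R n).

(** Measurability and domination are required eventually only, because
    difference quotients in time make sense only once the step is small enough
    to stay in the time interval of the solution. *)
Lemma integral_on_dominated (n : nat) (f_ : nat -> 'rV[R]_n -> R)
    (f g : 'rV[R]_n -> R) :
  (\forall k \near \oo, measurable_rV (f_ k)) ->
    (forall y, f_ k y @[k --> \oo] --> f y) ->
  integrable_on_space g ->
  (\forall k \near \oo, forall y, `|f_ k y| <= g y) ->
  integrable_on_space f /\
  integral_on setT (f_ k) @[k --> \oo] --> integral_on setT f.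
Proof.
move=> nmf ff ig ndom; have [N _ HN] := filterI nmf ndom.
have mf k : measurable_rV (f_ (k + N)%N) by apply: (HN _ _).1; exact: leq_addl.
have mfl : measurable_rV f.
  apply: (@measurable_fun_cvg _ _ _ _
    (fun k => f_ (k + N)%N \o @vec R n)) => // x _.
  by rewrite /= (cvg_shiftn N (fun k => f_ k (vec x))); exact: ff.
have [|||||ifl _ cv] := @dominated_convergence _ _ _ (mu n) setT measurableT
  (fun k y => (f_ (k + N) (vec y))%:E) (fun y => (f (vec y))%:E)
  (fun y => (g (vec y))%:E).
- by move=> k; apply/measurable_EFinP; exact: mf.
- exact/measurable_EFinP.
- apply: aeW => y _; apply/cvg_EFin; first exact: nearW.
  by rewrite (cvg_shiftn N (fun k => f_ k (vec y))); exact: ff.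
- by [].
- by apply: aeW => y k _; rewrite lee_fin; apply: (HN _ _).2; exact: leq_addl.
split=> //.
rewrite -(cvg_shiftn N (fun k => integral_on setT (f_ k))).
have c2 : [sequence (\int[mu n]_x (f_ (k + N) (vec x))%:E)%E]_k @ \oo -->
    (integral_on setT f)%:E.
  by rewrite /integral_on /Rintegral fineK//; exact: integrable_fin_num ifl.
exact: fine_cvg c2.
Qed.

Lemma Rintegral_sum (n : nat) (I : Type) (s : seq I)
  (F : I -> n.-tuple T -> R) :
  (forall i, (mu n).-integrable setT (EFin \o F i)) ->
  \int[mu n]_y (\sum_(i <- s) F i y) = \sum_(i <- s) \int[mu n]_y F i y.
Proof.
move=> iF; elim: s => [|i s IH].
  by under eq_Rintegral do rewrite big_nil;
    rewrite Rintegral_cst// mul0r big_nil.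
under eq_Rintegral do rewrite big_cons.
rewrite big_cons RintegralD// ?IH//.
rewrite (_ : _ \o _ = fun y => (\sum_(i <- s) (F i y)%:E)%E).
  by apply: integrable_sum => // j _; exact: iF.
by apply/funext => y /=; rewrite sumEFin.
Qed.

(** Neighbouring closed cells share a face; the half-open ones are disjoint, so
    a lattice sum is literally the integral of a step function. *)
Definition halfcube (n : nat) (c : 'rV[R]_n) (h : R) : set 'rV[R]_n :=
  [set y | forall v, - (h / 2) <= y 0 v - c 0 v < h / 2].

Lemma measurable_halfcube (n : nat) (c : 'rV[R]_n) (h : R) :
  measurable (@vec R n @^-1` halfcube c h : set (n.-tuple T)).
Proof.
rewrite (_ : _ @^-1` _ = \bigcap_(i in [set: 'I_n])
  ((fun y : n.-tuple T => tnth y i) @^-1`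
    `[c 0 i - h / 2, c 0 i + h / 2[%classic)).
  apply: fin_bigcap_measurable => // i _.
  by rewrite -[X in measurable X]setTI; apply: measurable_tnth.
apply/seteqP; split=> y /= H i.
  move=> _ /=; rewrite in_itv/=; have := H i.
  by rewrite mxE lerBrDr ltrBlDr addrC [h / 2 + _]addrC.
have := H i Logic.I; rewrite /= in_itv/=.
by rewrite mxE lerBrDr ltrBlDr addrC [h / 2 + _]addrC.
Qed.

Lemma halfcube_subset (n : nat) (c : 'rV[R]_n) (h : R) :
  halfcube c h `<=` cube c h.
Proof.
by move=> y /= H v; have /andP[? ?] := H v; rewrite ler_norml; apply/andP;
  split=> //; exact: ltW.
Qed.

(** The two cubes differ by the faces on which one coordinate is maximal. Each
    of them is a degenerate box, hence has measure zero. *)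
Lemma integral_on_halfcube (n : nat) (f : 'rV[R]_n -> R) (c : 'rV[R]_n)
    (h : R) : 0 <= h -> continuous f ->
  integral_on (halfcube c h) f = integral_on (cube c h) f.
Proof.
move=> h0 cf; apply/esym; rewrite /integral_on /Rintegral; congr fine.
(* [N v] is the closed face on which coordinate [v] is maximal *)
pose a (v i : 'I_n) := if i == v then c 0 v + h / 2 else c 0 i - h / 2.
pose N v : set (n.-tuple T) :=
  [set y | forall i, a v i <= tnth y i <= c 0 i + h / 2].
have mN v : measurable (N v).
  rewrite (_ : N v = \bigcap_(i in [set: 'I_n])
    ((fun y : n.-tuple T => tnth y i) @^-1` `[a v i, c 0 i + h / 2]%classic)).
    apply: fin_bigcap_measurable => // i _.
    by rewrite -[X in measurable X]setTI; apply: measurable_tnth.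
  apply/seteqP; split=> y /= H i.
    by move=> _ /=; rewrite in_itv/=; exact: H.
  by have := H i Logic.I; rewrite /= in_itv/=.
have N0 v : mu n (N v) = 0%E.
  rewrite lebesgue_tuple_box; last first.
    by move=> i; rewrite /a; case: eqP => [->//|_]; lra.
  by rewrite (bigD1 v)//= /a eqxx subrr mul0r.
have mU : measurable (\bigcup_(v in [set: 'I_n]) N v).
  exact: fin_bigcup_measurable.
have U0 : mu n (\bigcup_(v in [set: 'I_n]) N v) = 0%E.
  apply: measure_negligible => //.
  rewrite (_ : \bigcup_(v in _) _ = \big[setU/set0]_(v < n) N v); last first.
    rewrite -bigcup_seq; apply: eq_bigcupl; split=> v //= _.
    exact: mem_index_enum.
  elim/big_ind : _ => [||v _]; first exact: negligible_set0.
  - by move=> A B mA mB; apply: negligibleU.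
  - by apply/negligibleP; [exact: mN|exact: N0].
rewrite (negligible_integral mU (measurable_cube c h) _ U0); last first.
  exact: integrable_cube.
congr (integral _ _ _); apply/seteqP; split=> y /=.
  move=> [cy nN] v; have := cy v; rewrite ler_norml => /andP[-> ]/=.
  rewrite le_eqVlt => /predU1P[E|//]; exfalso; apply: nN; exists v => // i.
  rewrite /N/= /a; have := cy i; rewrite ler_distl mxE => /andP[c1 c2].
  case: eqP => [->|_]; last by rewrite c1.
  by rewrite -E mxE addrC subrK lexx.
move=> H; split; first exact: halfcube_subset.
move=> [v _ /(_ v)]; rewrite /a eqxx; have := H v; rewrite mxE; lra.
Qed.

End dominated.

(** * Lattice geometry and lattice sums *)

Section lattice_geometry.
Context {R : realType} {d : nat}.
Local Notation E := 'rV[R]_d.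
Local Notation T := (measurableTypeR R).
Local Notation mu := (lebesgue_tuple R).
Implicit Types L : lattice R d.

Lemma pointE L (i : vertex L) v :
  point i 0 v = origin L 0 v + spacing L * (i v)%:R.
Proof. by rewrite !mxE. Qed.

Lemma cellE L (i : vertex L) : cell i = cube (point i) (spacing L).
Proof. by []. Qed.

Lemma grid_unique (h : R) (a b : int) : 0 < h -> `|h * a%:~R - h * b%:~R| < h ->
  a = b.
Proof.
move=> h0; rewrite -mulrBr normrM gtr0_norm// -[ltRHS]mulr1 ltr_pM2l//.
rewrite -rmorphB -intr_norm (_ : 1 = 1%:~R)// ltr_int => H; lia.
Qed.

Lemma point_inj L (i j : vertex L) :
  (forall v, `|point i 0 v - point j 0 v| < spacing L) -> i = j.
Proof.
move=> H; apply/ffunP => v; apply: val_inj => /=.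
have := H v; rewrite !pointE opprD addrACA subrr add0r.
by move=> /(@grid_unique _ (Posz _) (Posz _) (spacing_gt0 L)) [].
Qed.

Lemma halfcube_unique L (i j : vertex L) y :
  halfcube (point i) (spacing L) y -> halfcube (point j) (spacing L) y -> i = j.
Proof.
move=> yi yj; apply: point_inj => v.
have := yi v; have := yj v => /andP[? ?] /andP[? ?].
by rewrite ltr_norml; apply/andP; split; lra.
Qed.

(** A lattice is a finite box of the infinite grid; a grid point lies in it as
    soon as some cell covers this point, because two grid points in the same
    cell are equal. *)
Lemma grid_vertex L (p : E) (z : 'I_d -> int) :
  (forall v, p 0 v = origin L 0 v + spacing L * (z v)%:~R) ->
  (exists i : vertex L, cell i p) -> exists i : vertex L, point i = p.
Proof.
move=> pE [i ip]; exists i; apply/rowP => v.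
have h0 := spacing_gt0 L.
have := ip v; rewrite !pointE pE opprD addrACA subrr add0r => H.
have -> // : z v = Posz (i v).
apply: (grid_unique h0); rewrite (le_lt_trans H)//; lra.
Qed.

(** The point of the grid obtained by rounding the coordinates of [y] is
    covered by a closed cell, hence is a vertex, and its half-open cell
    contains [y]. The margin [spacing L] pays for the rounding. *)
Lemma halfcube_cover L (y : E) (r : R) : `|y| <= r ->
  (forall p : E, `|p| <= r + spacing L -> exists i : vertex L, cell i p) ->
  exists i : vertex L, halfcube (point i) (spacing L) y.
Proof.
move=> yr cov; have h0 := spacing_gt0 L; set h := spacing L in h0 *.
(* adding 1/2 before taking the floor rounds to the nearest grid point *)
pose z (v : 'I_d) : int := Num.floor ((y 0 v - origin L 0 v) / h + 2^-1).
pose p : E := \row_v (origin L 0 v + h * (z v)%:~R).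
have pv v : p 0 v = origin L 0 v + h * (z v)%:~R by rewrite mxE.
have yp v : - (h / 2) <= y 0 v - p 0 v < h / 2.
  have /real_floor_itv/andP[] : (y 0 v - origin L 0 v) / h + 2^-1 \is Num.real.
    exact: num_real.
  rewrite -/(z v) rmorphD/= => z1 z2; rewrite pv.
  have e : h * ((y 0 v - origin L 0 v) / h + 2^-1) = y 0 v - origin L 0 v
    + h / 2.
    by field; rewrite gt_eqF.
  move: z1 z2; rewrite -(ler_pM2l h0) -(ltr_pM2l h0) e mulrDr mulr1 => z1 z2.
  by apply/andP; split; lra.
have [|i ip] := @grid_vertex L p z pv.
  apply: cov; rewrite -(subrK y p) (le_trans (ler_normD _ _))// [leLHS]addrC
    lerD//.
  apply: (@le_trans _ _ (h / 2)); last by rewrite -/h; lra.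
  apply/rV_normP; first lra.
  move=> v; have -> : (p - y) 0 v = p 0 v - y 0 v by rewrite !mxE.
  by have /andP[? ?] := yp v; rewrite ler_norml; apply/andP; split; lra.
by exists i => v; rewrite ip; exact: yp.
Qed.

End lattice_geometry.

Section lattice_sums.
Context {R : realType} {d : nat}.
Local Notation E := 'rV[R]_d.
Local Notation T := (measurableTypeR R).
Local Notation mu := (lebesgue_tuple R).

Lemma lattice_sum_integral (L : lattice R d) (K w : E -> R) : continuous w ->
  \sum_i K (point i) * @cell_mass R d L w i =
  integral_on setT
    (fun y => \sum_i K (point i) *
      (w \_ (halfcube (@point R d L i) (spacing L))) y)
  /\ measurable_rV
    (fun y => \sum_i K (point i) *
      (w \_ (halfcube (@point R d L i) (spacing L))) y).
Proof.
move=> cw; have h0 := ltW (spacing_gt0 L).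
pose F (i : vertex L) y :=
  K (point i) * (w \_ (halfcube (point i) (spacing L))) (@vec R d y).
have mC i := @measurable_halfcube R d (point (i : vertex L)) (spacing L).
have FE i : (fun y => (w \_ (halfcube (point i) (spacing L))) (@vec R d y)) =
    (w \o @vec R d) \_ (@vec R d @^-1` halfcube (point (i : vertex L))
      (spacing L)).
  by apply/funext => y; rewrite !patchE/=.
have iw i : (mu d).-integrable
  (@vec R d @^-1` halfcube (point (i : vertex L)) (spacing L))
    (EFin \o (w \o @vec R d)).
  by apply: (integrableS (measurable_cube _ _) (mC i)
    (fun y => @halfcube_subset R d _ _ (vec y)) (integrable_cube _ h0 cw)).
have iw' i : (mu d).-integrable setT
    (EFin \o (fun y => (w \_ (halfcube (point (i : vertex L)) (spacing L)))
      (@vec R d y))).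
  rewrite FE -restrict_EFin; apply/(integrable_restrict _ (mC i) measurableT).
  by rewrite setTI; exact: iw.
have iF i : (mu d).-integrable setT (EFin \o F i).
  rewrite (_ : _ \o _ = fun y => ((K (point i))%:E *
    ((w \_ (halfcube (point i) (spacing L))) (@vec R d y))%:E)%E).
    by apply: integrableZl => //; exact: iw'.
  by apply/funext => y; rewrite /= EFinM.
split; last first.
  rewrite /measurable_rV.
  rewrite (_ : _ \o _ = fun y => \sum_i F i y)//.
  by apply: measurable_sum => i; apply/measurable_EFinP;
    have /integrableP[] := iF i.
rewrite /integral_on preimage_setT (@Rintegral_sum _ _ _ _ F)//.
apply: eq_bigr => i _; rewrite /F (RintegralZl _ measurableT (iw' i)).
congr (_ * _); rewrite /cell_mass cellE -integral_on_halfcube//.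
rewrite /integral_on FE -Rintegral_mkcond//.
Qed.

(** The lattice sum is the integral of the step function whose value on each
    cell is the sample of [K k] at its centre times the density. At a given [y]
    the centre of the cell of [y] tends to [y], so the step functions converge
    pointwise, and dominated convergence applies. The bound has to be uniform
    for samples taken within [del] of [y]. *)
Lemma lattice_sum_cvg (L : nat -> lattice R d) (K w : nat -> E -> R)
    (Kl wl g : E -> R) (del : R) :
  refining L -> (forall k, continuous (w k)) ->
  (forall y, w k y @[k --> \oo] --> wl y) ->
  (forall y (z : nat -> E), z k @[k --> \oo] --> y ->
    K k (z k) @[k --> \oo] --> Kl y) ->
  0 < del -> integrable_on_space g ->
  (\forall k \near \oo, forall y z, `|z - y| <= del -> `|K k z * w k y| <=
    g y) ->
  \sum_i K k (point i) * @cell_mass R d (L k) (w k) i @[k --> \oo] -->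
  integral_on setT (fun y => Kl y * wl y).
Proof.
move=> [h0 cov] cw cwl cK del0 ig dom.
have hsmall e : 0 < e -> \forall k \near \oo, spacing (L k) <= e.
  move=> e0; have /cvgrPdist_le/(_ _ e0) := h0; apply: filterS => k.
  by rewrite sub0r normrN gtr0_norm// spacing_gt0.
pose f_ k y := \sum_i K k (point i) *
  (w k \_ (halfcube (@point R d (L k) i) (spacing (L k)))) y.
have fin k i y : halfcube (@point R d (L k) i) (spacing (L k)) y ->
    f_ k y = K k (point i) * w k y.
  move=> yi; rewrite /f_ (bigD1 i)//= patchE mem_set// big1 ?addr0// => j ji.
  rewrite patchE memNset ?mulr0// => yj; move/eqP : ji; apply.
  exact: halfcube_unique yj yi.
have fout k y : (forall i, ~ halfcube (@point R d (L k) i) (spacing (L k)) y) ->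
    f_ k y = 0.
  by move=> yi; rewrite /f_ big1// => j _; rewrite patchE memNset ?mulr0.
under eq_fun do rewrite (lattice_sum_integral _ _ (cw _)).1.
apply: (@integral_on_dominated _ _ f_ _ g _ _ ig _).2.
- by apply: nearW => k; exact: (lattice_sum_integral _ _ (cw k)).2.
- move=> y.
  have Hi k : exists z : E, `|z - y| <= spacing (L k) /\
     ((exists i : vertex (L k), halfcube (point i) (spacing (L k)) y) ->
       f_ k y = K k z * w k y).
    have [[i yi]|n] := pselect
      (exists i : vertex (L k), halfcube (point i) (spacing (L k)) y).
      exists (point i); split; last by move=> _; exact: fin.
      have hk := spacing_gt0 (L k).
      rewrite distrC (le_trans (cube_norm (ltW hk)
        (halfcube_subset yi)))//; lra.
    by exists y; split=> //; rewrite subrr normr0 ltW// spacing_gt0.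
  have [z zP] := choice Hi.
  have zy : z k @[k --> \oo] --> y.
    apply/cvgrPdist_le => e /hsmall; apply: filterS => k hk.
    by rewrite distrC (le_trans _ hk)//; have [] := zP k.
  have : K k (z k) * w k y @[k --> \oo] --> Kl y * wl y.
    by apply: cvgM => //; exact: cK.
  apply: cvg_trans; apply: near_eq_cvg.
  have c1 := hsmall 1 ltr01.
  have c2 := cov (`|y| + 1).
  apply: filterS2 c1 c2 => k k1 k2; apply/esym.
  have [_] := zP k; apply.
  apply: (@halfcube_cover _ _ _ _ `|y|) => // p pr; apply: k2.
  by rewrite (le_trans pr)// lerD2l.
- apply: filterS2 dom (hsmall _ del0) => k domk hk y.
  have [[i yi]|n] := pselect
    (exists i : vertex (L k), halfcube (point i) (spacing (L k)) y).
    rewrite (fin _ _ _ yi); apply: domk.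
    have sk := spacing_gt0 (L k).
    rewrite distrC (le_trans (cube_norm (ltW sk) (halfcube_subset yi)))//; lra.
  rewrite fout; last by move=> i yi; apply: n; exists i.
  rewrite normr0 (le_trans _ (domk y y _))// subrr normr0 ltW//.
Qed.

End lattice_sums.

(** * Limits along sequences *)

Section pointwise.
Context {R : realType} {U : normedModType R}.
Implicit Types f g : U -> R.

Lemma continuous_fun_add f g : continuous f -> continuous g ->
  continuous (fun x => f x + g x).
Proof. by move=> cf cg x; apply: cvgD; [exact: cf|exact: cg]. Qed.

Lemma continuous_fun_sub f g : continuous f -> continuous g ->
  continuous (fun x => f x - g x).
Proof. by move=> cf cg x; apply: cvgB; [exact: cf|exact: cg]. Qed.

Lemma continuous_fun_mul f g : continuous f -> continuous g ->
  continuous (fun x => f x * g x).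
Proof. by move=> cf cg x; apply: cvgM; [exact: cf|exact: cg]. Qed.

Lemma continuous_fun_cst (k : R) : continuous (fun _ : U => k).
Proof. by move=> x; exact: cvg_cst. Qed.

End pointwise.

Section sequential.
Context {R : realType}.

Lemma difference_quotient_cvg (U : normedModType R) (A : set U) (f : U -> R)
    (v p : U) (q : nat -> U) (h : nat -> R) :
  open A -> A p -> (forall x, A x -> derivable f x v) ->
  {for p, continuous ('D_v f)} ->
  q k @[k --> \oo] --> p -> h k @[k --> \oo] --> 0 -> (forall k, h k != 0) ->
  (f (q k + h k *: v) - f (q k)) / h k @[k --> \oo] --> 'D_v f p.
Proof.
move=> oA Ap df cf qp h0 hn0; apply/cvgrPdist_le => e e0.
have nA : \forall x \near p, derivable f x v.
  by apply: filterS (open_nbhs_nbhs (conj oA Ap)) => x; exact: df.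
have [del del0 H] := difference_quotient_near nA cf e0.
have /cvgrPdist_lt/(_ _ del0) qp' := qp.
have /cvgrPdist_lt/(_ _ del0) hp' := h0.
apply: filterS2 qp' hp' => k k1 k2.
by rewrite distrC; apply: H => //;
  [rewrite distrC|move: k2; rewrite sub0r normrN].
Qed.

Lemma second_difference_cvg (U : normedModType R) (A : set U) (f : U -> R)
    (v p : U) (q : nat -> U) (h : nat -> R) :
  open A -> A p -> (forall x, A x -> derivable f x v) ->
  (forall x, A x -> derivable ('D_v f) x v) ->
  {for p, continuous ('D_v ('D_v f))} ->
  q k @[k --> \oo] --> p -> h k @[k --> \oo] --> 0 -> (forall k, h k != 0) ->
  (f (q k + h k *: v) - 2 * f (q k) + f (q k - h k *: v)) / h k ^+ 2
    @[k --> \oo] --> 'D_v ('D_v f) p.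
Proof.
move=> oA Ap df df2 cf qp h0 hn0; apply/cvgrPdist_le => e e0.
have nA : \forall x \near p, derivable f x v.
  by apply: filterS (open_nbhs_nbhs (conj oA Ap)) => x; exact: df.
have nA2 : \forall x \near p, derivable ('D_v f) x v.
  by apply: filterS (open_nbhs_nbhs (conj oA Ap)) => x; exact: df2.
have [del del0 H] := second_difference_near nA nA2 cf e0.
have /cvgrPdist_lt/(_ _ del0) qp' := qp.
have /cvgrPdist_lt/(_ _ del0) hp' := h0.
apply: filterS2 qp' hp' => k k1 k2.
by rewrite distrC; apply: H => //;
  [rewrite distrC|move: k2; rewrite sub0r normrN].
Qed.

(** In a normed space a discontinuity is witnessed by a sequence, picked at
    distance less than [1 / (k + 1)]. *)
Lemma continuous_seq (U : normedModType R) (f : U -> R) (p : U) :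
  (forall q : nat -> U, q k @[k --> \oo] --> p ->
    f (q k) @[k --> \oo] --> f p) -> {for p, continuous f}.
Proof.
move=> H; apply/cvgrPdist_le => e e0; apply: contrapT => nH.
have bad (k : nat) : exists q : U, `|p - q| < k.+1%:R^-1 /\ ~ `|f p - f q| <= e.
  apply: contrapT => /forallNP nq; apply: nH.
  apply/nbhs_ballP; exists k.+1%:R^-1; first by rewrite /= invr_gt0.
  move=> q; rewrite -ball_normE /= => qk.
  by apply: contrapT => nle; apply: (nq q).
have [q qP] := choice bad.
have qp : q k @[k --> \oo] --> p.
  apply/cvgrPdist_lt => r r0.
  have : (fun k : nat => k.+1%:R^-1 : R) @ \oo --> 0 by exact: cvg_harmonic.
  move=> /cvgrPdist_lt /(_ _ r0); apply: filterS => k.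
  rewrite sub0r normrN ger0_norm; last by rewrite invr_ge0.
  by apply: lt_trans; have [] := qP k.
have /cvgrPdist_le/(_ _ e0)[N _ /(_ N (leqnn N))] := H q qp.
by have [] := qP N.
Qed.

(** Convergence along every sequence [z k] is a substitute for uniform
    convergence: choosing [z k] as a point of the cube where the estimate
    fails, if there is one, shows that it eventually holds on the whole cube.
    *)
Lemma cube_average_cvg (n : nat) (F : nat -> 'rV[R]_n -> R)
    (c : nat -> 'rV[R]_n) (cl : 'rV[R]_n) (h : nat -> R) (l : R) :
  (forall k, 0 < h k) -> h k @[k --> \oo] --> 0 -> c k @[k --> \oo] --> cl ->
  (forall k, continuous (F k)) ->
  (forall z : nat -> 'rV[R]_n, z k @[k --> \oo] --> cl ->
    F k (z k) @[k --> \oo] --> l) ->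
  integral_on (cube (c k) (h k)) (F k) / h k ^+ n @[k --> \oo] --> l.
Proof.
move=> h0 hl cc cF HF; apply/cvgrPdist_le => e e0.
have pick k : exists z, cube (c k) (h k) z /\
    (`|F k z - l| <= e -> forall y, cube (c k) (h k) y -> `|F k y - l| <= e).
  have [[z [cz zP]]|nz] := pselect
    (exists z, cube (c k) (h k) z /\ ~ `|F k z - l| <= e).
    by exists z.
  exists (c k); split; first by move=> v; rewrite subrr normr0 divr_ge0// ltW.
  by move=> _ y cy; apply: contrapT => ny; apply: nz; exists y.
have [z zP] := choice pick.
have zl : z k @[k --> \oo] --> cl.
  have -> : cl = 0 + cl by rewrite add0r.
  rewrite (_ : z = fun k => (z k - c k) + c k); last by apply/funext => k;
    rewrite subrK.
  apply: cvgD => //; apply/cvgrPdist_le => r r0.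
  have /cvgrPdist_le/(_ _ r0) := hl; apply: filterS => k.
  rewrite !sub0r !normrN gtr0_norm// => hr.
  rewrite (le_trans (cube_norm (ltW (h0 k)) (zP k).1))//.
  by rewrite (le_trans _ hr)//; have := h0 k; lra.
have /cvgrPdist_le/(_ _ e0) := HF z zl; apply: filterS => k.
rewrite distrC => /((zP k).2) zk.
have hn : 0 < h k ^+ n by rewrite exprn_gt0.
have := cube_integral_near (ltW (h0 k)) (cF k) zk.
rewrite -[X in _ - X](divfK (lt0r_neq0 hn)).
have -> : integral_on (cube (c k) (h k)) (F k)
  - l * h k ^+ n / h k ^+ n * h k ^+ n =
  (integral_on (cube (c k) (h k)) (F k) / h k ^+ n - l) * h k ^+ n.
  by field; rewrite expf_neq0// gt_eqF.
by rewrite normrM (gtr0_norm hn) ler_pM2r// distrC.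
Qed.

End sequential.

Section uncurrying.
Context {R : realType} {U1 U2 : normedModType R}.

(** Smoothness is assumed jointly in both variables, whereas the equation and
    the scheme only involve derivatives in one of them; these lemmas identify
    the latter with directional derivatives of the joint function. *)
Lemma derive_uncurry1 (G : U1 -> U2 -> R) (v : U1) :
  'D_((v, 0) : U1 * U2) (fun p : U1 * U2 => G p.1 p.2) =
  (fun p => 'D_v (G^~ p.2) p.1).
Proof.
apply/funext => -[x y]; rewrite /derive/=.
have -> : (fun h : R => h^-1 *: (G (h *: v + x) (h *: (0 : U2) + y) - G x y)) =
    (fun h => h^-1 *: (G (h *: v + x) y - G x y)).
  by apply/funext => h; rewrite scaler0 add0r.
by [].
Qed.

Lemma derive_uncurry2 (G : U1 -> U2 -> R) (v : U2) :
  'D_((0, v) : U1 * U2) (fun p : U1 * U2 => G p.1 p.2) =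
  (fun p => 'D_v (G p.1) p.2).
Proof.
apply/funext => -[x y]; rewrite /derive/=.
have -> : (fun h : R => h^-1 *: (G (h *: (0 : U1) + x) (h *: v + y) - G x y)) =
    (fun h => h^-1 *: (G x (h *: v + y) - G x y)).
  by apply/funext => h; rewrite scaler0 add0r.
by [].
Qed.

Lemma derivable_uncurry1 (G : U1 -> U2 -> R) (v : U1) x y :
  derivable (fun p : U1 * U2 => G p.1 p.2) (x, y) (v, 0) ->
  derivable (G^~ y) x v.
Proof.
rewrite /derivable/=.
have -> : (fun h : R => h^-1 *: (G (h *: v + x) (h *: (0 : U2) + y) - G x y)) =
    (fun h => h^-1 *: (G (h *: v + x) y - G x y)).
  by apply/funext => h; rewrite scaler0 add0r.
by [].
Qed.

Lemma derivable_uncurry2 (G : U1 -> U2 -> R) (v : U2) x y :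
  derivable (fun p : U1 * U2 => G p.1 p.2) (x, y) (0, v) ->
  derivable (G x) y v.
Proof.
rewrite /derivable/=.
have -> : (fun h : R => h^-1 *: (G (h *: (0 : U1) + x) (h *: v + y) - G x y)) =
    (fun h => h^-1 *: (G x (h *: v + y) - G x y)).
  by apply/funext => h; rewrite scaler0 add0r.
by [].
Qed.

Lemma iter_derive_uncurry1 (G : U1 -> U2 -> R) (s : seq U1) :
  iter_derive [seq (v, 0) : U1 * U2 | v <- s] (fun p => G p.1 p.2) =
  (fun p => iter_derive s (G^~ p.2) p.1).
Proof. by elim: s => //= v s ->;
  exact: (derive_uncurry1 (fun x y => iter_derive s (G^~ y) x)). Qed.

Lemma iter_derive_uncurry2 (G : U1 -> U2 -> R) (s : seq U2) :
  iter_derive [seq (0, v) : U1 * U2 | v <- s] (fun p => G p.1 p.2) =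
  (fun p => iter_derive s (G p.1) p.2).
Proof. by elim: s => //= v s ->;
  exact: (derive_uncurry2 (fun x y => iter_derive s (G x) y)). Qed.

End uncurrying.

(** * Partial derivatives of the kernel and of the density *)

Lemma eq_cvg_seq {R : realType} (f g : nat -> R) (l l' : R) :
  f k @[k --> \oo] --> l -> l = l' -> (forall k, f k = g k) ->
  g k @[k --> \oo] --> l'.
Proof. by move=> + <- /funext <-. Qed.

Section smooth_data.
Context {R : realType} {d : nat}.
Local Notation E := 'rV[R]_d.

Definition partials (s : seq 'I_d) : (E -> R) -> E -> R :=
  iter_derive [seq basis_vec R v | v <- s].

Section kernel.
Variable W : E -> E -> R.
Hypothesis W_smooth : smooth_on setT (fun p : E * E => W p.1 p.2).

Definition W_partial s x z := partials s (W^~ z) x.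

Lemma uncurry_W_partial (s : seq 'I_d) :
  iter_derive [seq (basis_vec R v, 0) : E * E | v <- s]
    (fun p : E * E => W p.1 p.2) =
  (fun p => W_partial s p.1 p.2).
Proof.
rewrite /W_partial /partials -iter_derive_uncurry1.
by rewrite -map_comp.
Qed.

Lemma W_partial_continuous s (p : E * E) :
  {for p, continuous (fun p : E * E => W_partial s p.1 p.2)}.
Proof. by rewrite -uncurry_W_partial; exact: (W_smooth _ _).1. Qed.

Lemma W_partial_derivable2 s (p : E * E) v :
  derivable (fun p : E * E => W_partial s p.1 p.2) p (basis_vec R v, 0).
Proof. by rewrite -uncurry_W_partial; exact: (W_smooth _ _).2. Qed.

Lemma W_partial_derivable s x z v : derivable (W_partial s ^~ z) x
  (basis_vec R v).
Proof. exact: (@derivable_uncurry1 R E E (W_partial s) _ x z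
  (@W_partial_derivable2 s (x, z) v)). Qed.

Lemma uncurry_W_partialS s v : 'D_((basis_vec R v, 0) : E * E)
  (fun p : E * E => W_partial s p.1 p.2) =
  (fun p => W_partial (v :: s) p.1 p.2).
Proof. by rewrite -!uncurry_W_partial. Qed.

Lemma uncurry_W_partialSS v : 'D_((basis_vec R v, 0) : E * E)
    ('D_((basis_vec R v, 0) : E * E)
      (fun p : E * E => W_partial [::] p.1 p.2)) =
  (fun p => W_partial [:: v; v] p.1 p.2).
Proof. rewrite (uncurry_W_partialS [::] v);
  exact: (uncurry_W_partialS [:: v] v). Qed.

Lemma W_partial_cvg s (x_ z_ : nat -> E) x z : x_ k @[k --> \oo] --> x ->
  z_ k @[k --> \oo] --> z ->
    W_partial s (x_ k) (z_ k) @[k --> \oo] --> W_partial s x z.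
Proof.
move=> cx cz.
exact: (cvg_comp (fun k => (x_ k, z_ k)) (fun p : E * E => W_partial s p.1 p.2)
  (cvg_pair cx cz) (@W_partial_continuous s (x, z))).
Qed.

Lemma W_partial_quotient_cvg s v (x_ z_ : nat -> E) (h_ : nat -> R) x z :
  x_ k @[k --> \oo] --> x -> z_ k @[k --> \oo] --> z ->
  h_ k @[k --> \oo] --> 0 -> (forall k, h_ k != 0) ->
  (W_partial s (x_ k + h_ k *: basis_vec R v) (z_ k)
    - W_partial s (x_ k) (z_ k)) / h_ k
    @[k --> \oo] --> W_partial (v :: s) x z.
Proof.
move=> cx cz ch hn0.
have := @difference_quotient_cvg R (E * E)%type setT
  (fun p : E * E => W_partial s p.1 p.2) (basis_vec R v, 0) (x, z)
  (fun k => (x_ k, z_ k)) h_ openT Logic.I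
    (fun p _ => @W_partial_derivable2 s p v).
move=> /(_ _ (cvg_pair cx cz) ch hn0)/eq_cvg_seq; apply => [||k].
- exact: (eq_ind_r (fun f => {for (x, z), continuous f})
    (@W_partial_continuous (v :: s) (x, z)) (uncurry_W_partialS s v)).
- exact: (congr1 (fun f => f (x, z)) (uncurry_W_partialS s v)).
- by rewrite /= scaler0 addr0.
Qed.

Lemma W_partial_second_cvg v (x_ z_ : nat -> E) (h_ : nat -> R) x z :
  x_ k @[k --> \oo] --> x -> z_ k @[k --> \oo] --> z ->
  h_ k @[k --> \oo] --> 0 -> (forall k, h_ k != 0) ->
  (W (x_ k + h_ k *: basis_vec R v) (z_ k) - 2 * W (x_ k) (z_ k)
    + W (x_ k - h_ k *: basis_vec R v) (z_ k)) / h_ k ^+ 2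
    @[k --> \oo] --> W_partial [:: v; v] x z.
Proof.
move=> cx cz ch hn0.
have := @second_difference_cvg R (E * E)%type setT
  (fun p : E * E => W_partial [::] p.1 p.2) (basis_vec R v, 0) (x, z)
  (fun k => (x_ k, z_ k)) h_ openT Logic.I
    (fun p _ => @W_partial_derivable2 [::] p v).
move=> /(_ _ _ (cvg_pair cx cz) ch hn0)/eq_cvg_seq; apply => [p _|||k].
- exact: (eq_ind_r (fun f => derivable f p (basis_vec R v, 0))
    (@W_partial_derivable2 [:: v] p v) (uncurry_W_partialS [::] v)).
- exact: (eq_ind_r (fun f => {for (x, z), continuous f})
    (@W_partial_continuous [:: v; v] (x, z)) (uncurry_W_partialSS v)).
- exact: (congr1 (fun f => f (x, z)) (uncurry_W_partialSS v)).
- by rewrite /= scaler0 addr0 subr0.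
Qed.

End kernel.

Section density.
Variables (rho : R -> E -> R) (T : R).
Hypothesis rho_smooth : smooth_on [set p : R^o * E | 0 < p.1 < T]
  (fun p => rho p.1 p.2).

Definition rho_partial s t x := partials s (rho t) x.
Definition rho_rate t x := 'D_(1 : R^o) (rho ^~ x : R^o -> R) t.

(** Smoothness of the density is only assumed on this strip, and difference
    quotients need room around the base point. *)
Lemma open_strip : open [set p : R^o * E | 0 < p.1 < T].
Proof.
rewrite (_ : [set _ | _] = fst @^-1` `]0, T[%classic).
  apply: open_comp; last exact: interval_open.
  by move=> p _; exact: cvg_fst.
by apply/seteqP; split=> p /=; rewrite in_itv.
Qed.

Lemma uncurry_rho_partial (s : seq 'I_d) :
  iter_derive [seq (0, basis_vec R v) : R^o * E | v <- s]
    (fun p : R^o * E => rho p.1 p.2) = (fun p => rho_partial s p.1 p.2).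
Proof.
rewrite /rho_partial /partials.
rewrite -(@iter_derive_uncurry2 R R^o E rho).
by rewrite -map_comp.
Qed.

Lemma uncurry_rho_partialS s v :
  'D_((0, basis_vec R v) : R^o * E) (fun p : R^o * E => rho_partial s p.1 p.2) =
  (fun p => rho_partial (v :: s) p.1 p.2).
Proof. by rewrite -!uncurry_rho_partial. Qed.

Lemma uncurry_rho_partialSS v : 'D_((0, basis_vec R v) : R^o * E)
    ('D_((0, basis_vec R v) : R^o * E)
      (fun p : R^o * E => rho_partial [::] p.1 p.2)) =
  (fun p => rho_partial [:: v; v] p.1 p.2).
Proof. rewrite (uncurry_rho_partialS [::] v);
  exact: (uncurry_rho_partialS [:: v] v). Qed.

Lemma uncurry_rho_rate :
  'D_((1, 0) : R^o * E) (fun p : R^o * E => rho p.1 p.2) =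
  (fun p => rho_rate p.1 p.2).
Proof. exact: derive_uncurry1. Qed.

Lemma rho_partial_continuous2 s (p : R^o * E) : 0 < p.1 < T ->
  {for p, continuous (fun p : R^o * E => rho_partial s p.1 p.2)}.
Proof. by move=> Ap; rewrite -uncurry_rho_partial;
  exact: (rho_smooth _ Ap).1. Qed.

Lemma rho_rate_continuous2 (p : R^o * E) : 0 < p.1 < T ->
  {for p, continuous (fun p : R^o * E => rho_rate p.1 p.2)}.
Proof.
by move=> Ap; rewrite -uncurry_rho_rate; exact: (rho_smooth [:: (1, 0)] Ap).1.
Qed.

Lemma rho_partial_derivable2 s (p : R^o * E) v : 0 < p.1 < T ->
  derivable (fun p : R^o * E => rho_partial s p.1 p.2) p (0, basis_vec R v).
Proof. by move=> Ap; rewrite -uncurry_rho_partial;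
  exact: (rho_smooth _ Ap).2. Qed.

Lemma rho_partial_derivable s t x v : 0 < t < T ->
  derivable (rho_partial s t) x (basis_vec R v).
Proof.
move=> tT.
exact: (@derivable_uncurry2 R R^o E (rho_partial s) _ t x
  (@rho_partial_derivable2 s (t, x) v tT)).
Qed.

Lemma rho_derivable_time t x : 0 < t < T -> derivable (rho ^~ x : R^o -> R) t 1.
Proof.
move=> tT; apply: (@derivable_uncurry1 R R^o E).
exact: (@rho_smooth [::] (t, x) tT).2.
Qed.

Lemma rho_partial_cvg s (t_ : nat -> R) (x_ : nat -> E) t x : 0 < t < T ->
  t_ k @[k --> \oo] --> t ->
  x_ k @[k --> \oo] --> x ->
    rho_partial s (t_ k) (x_ k) @[k --> \oo] --> rho_partial s t x.
Proof.
move=> tT ct cx.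
exact: (cvg_comp (fun k => (t_ k, x_ k))
  (fun p : R^o * E => rho_partial s p.1 p.2)
  (cvg_pair ct cx) (@rho_partial_continuous2 s (t, x) tT)).
Qed.

Lemma rho_rate_cvg (t_ : nat -> R) (x_ : nat -> E) t x : 0 < t < T ->
  t_ k @[k --> \oo] --> t ->
  x_ k @[k --> \oo] --> x ->
    rho_rate (t_ k) (x_ k) @[k --> \oo] --> rho_rate t x.
Proof.
move=> tT ct cx.
exact: (cvg_comp (fun k => (t_ k, x_ k)) (fun p : R^o * E => rho_rate p.1 p.2)
  (cvg_pair ct cx) (@rho_rate_continuous2 (t, x) tT)).
Qed.

Lemma rho_partial_continuous s t : 0 < t < T -> continuous (rho_partial s t).
Proof.
move=> tT x; apply: continuous_seq => q qx.
by apply: rho_partial_cvg => //; exact: cvg_cst.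
Qed.

Lemma rho_rate_continuous t : 0 < t < T -> continuous (rho_rate t).
Proof.
move=> tT x; apply: continuous_seq => q qx.
by apply: rho_rate_cvg => //; exact: cvg_cst.
Qed.

Lemma rho_quotient_cvg v (t_ : nat -> R) (x_ : nat -> E) (h_ : nat -> R) t x :
  0 < t < T -> t_ k @[k --> \oo] --> t -> x_ k @[k --> \oo] --> x ->
  h_ k @[k --> \oo] --> 0 -> (forall k, h_ k != 0) ->
  (rho (t_ k) (x_ k + h_ k *: basis_vec R v) - rho (t_ k) (x_ k)) / h_ k
    @[k --> \oo] --> rho_partial [:: v] t x.
Proof.
move=> tT ct cx ch hn0.
have := @difference_quotient_cvg R (R^o * E)%type _
  (fun p : R^o * E => rho_partial [::] p.1 p.2) (0, basis_vec R v) (t, x)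
  (fun k => (t_ k, x_ k)) h_ open_strip tT
    (fun p Ap => @rho_partial_derivable2 [::] p v Ap).
move=> /(_ _ (cvg_pair ct cx) ch hn0)/eq_cvg_seq; apply => [||k].
- exact: (eq_ind_r (fun f => {for (t, x), continuous f})
    (@rho_partial_continuous2 [:: v] (t, x) tT) (uncurry_rho_partialS [::] v)).
- exact: (congr1 (fun f => f (t, x)) (uncurry_rho_partialS [::] v)).
- by rewrite /= scaler0 addr0.
Qed.

Lemma rho_second_cvg v (t_ : nat -> R) (x_ : nat -> E) (h_ : nat -> R) t x :
  0 < t < T -> t_ k @[k --> \oo] --> t -> x_ k @[k --> \oo] --> x ->
  h_ k @[k --> \oo] --> 0 -> (forall k, h_ k != 0) ->
  (rho (t_ k) (x_ k + h_ k *: basis_vec R v) - 2 * rho (t_ k) (x_ k)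
   + rho (t_ k) (x_ k - h_ k *: basis_vec R v)) / h_ k ^+ 2
    @[k --> \oo] --> rho_partial [:: v; v] t x.
Proof.
move=> tT ct cx ch hn0.
have := @second_difference_cvg R (R^o * E)%type _
  (fun p : R^o * E => rho_partial [::] p.1 p.2) (0, basis_vec R v) (t, x)
  (fun k => (t_ k, x_ k)) h_ open_strip tT
    (fun p Ap => @rho_partial_derivable2 [::] p v Ap).
move=> /(_ _ _ (cvg_pair ct cx) ch hn0)/eq_cvg_seq; apply => [p Ap|||k].
- exact: (eq_ind_r (fun f => derivable f p (0, basis_vec R v))
    (@rho_partial_derivable2 [:: v] p v Ap) (uncurry_rho_partialS [::] v)).
- exact: (eq_ind_r (fun f => {for (t, x), continuous f})
    (@rho_partial_continuous2 [:: v; v] (t, x) tT) (uncurry_rho_partialSS v)).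
- exact: (congr1 (fun f => f (t, x)) (uncurry_rho_partialSS v)).
- by rewrite /= scaler0 addr0 subr0.
Qed.

Lemma rho_time_quotient_cvg (t_ : nat -> R) (x_ : nat -> E)
  (h_ : nat -> R) t x :
  0 < t < T -> t_ k @[k --> \oo] --> t -> x_ k @[k --> \oo] --> x ->
  h_ k @[k --> \oo] --> 0 -> (forall k, h_ k != 0) ->
  (rho (t_ k + h_ k) (x_ k) - rho (t_ k) (x_ k)) / h_ k
    @[k --> \oo] --> rho_rate t x.
Proof.
move=> tT ct cx ch hn0.
have := @difference_quotient_cvg R (R^o * E)%type _
  (fun p : R^o * E => rho p.1 p.2) (1, 0) (t, x)
  (fun k => (t_ k, x_ k)) h_ open_strip tT
    (fun p Ap => (@rho_smooth [::] p Ap).2 _).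
move=> /(_ _ (cvg_pair ct cx) ch hn0)/eq_cvg_seq; apply => [||k].
- exact: (eq_ind_r (fun f => {for (t, x), continuous f})
    (@rho_rate_continuous2 (t, x) tT) uncurry_rho_rate).
- exact: (congr1 (fun f => f (t, x)) uncurry_rho_rate).
- by rewrite /= scaler0 addr0 [h_ _ *: 1]mulr1.
Qed.

End density.

End smooth_data.

(** * The interaction term *)

(** Sequential form of differentiability; it lets dominated convergence for
    sequences differentiate under the integral sign. *)
Lemma is_derive_seq {R : realType} (U : normedModType R) (f : U -> R) (x v : U)
    (l : R) :
  (forall h : nat -> R, (forall k, h k != 0) -> h k @[k --> \oo] --> 0 ->
    (f (x + h k *: v) - f x) / h k @[k --> \oo] --> l) -> is_derive x v f l.
Proof.
move=> H.
have cv : h^-1 *: ((f \o shift x) (h *: v) - f x) @[h --> 0^'] --> l.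
  apply/(@cvgr_dnbhsP R (fun h => h^-1 *: ((f \o shift x) (h *: v) - f x)) 0 l).
  move=> u [un0 u0]; apply: eq_cvg_seq (H u un0 u0) _ _ => // k.
  by rewrite /= [x + _]addrC; exact: mulrC.
by split; [apply/cvg_ex; exists l|exact/cvg_lim].
Qed.

Lemma basis_vec_norm {R : realType} d (v : 'I_d) : `|basis_vec R v| <= 1.
Proof.
apply/rV_normP => // u; rewrite mxE eqxx/=.
by case: (_ == _); rewrite ?normr1 ?normr0.
Qed.

Section interaction_limits.
Context {R : realType} {d : nat}.
Local Notation E := 'rV[R]_d.
Variables (W : E -> E -> R) (rho : R -> E -> R) (T a b : R).
Hypothesis W_smooth : smooth_on setT (fun p : E * E => W p.1 p.2).
Hypothesis rho_smooth : smooth_on [set p : R^o * E | 0 < p.1 < T]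
  (fun p => rho p.1 p.2).
Hypothesis rho_gt0 : forall t x, 0 < t < T -> 0 < rho t x.
Hypothesis a_gt0 : 0 < a.
Hypothesis b_ltT : b < T.
Hypothesis dom : dominated_interaction W rho a b.

Lemma time_range t : a <= t <= b -> 0 < t < T.
Proof. by move=> /andP[at_ tb];
  rewrite (lt_le_trans a_gt0)// (le_lt_trans tb). Qed.

Lemma rho_continuous t : a <= t <= b -> continuous (rho t).
Proof. by move=> tab; exact: (@rho_partial_continuous R d rho T rho_smooth [::]
  t (time_range tab)). Qed.

(** [K k] is a kernel sampled at lattice points, with a limit [Kl]. The first
    clause is continuous convergence, as in [lattice_sum_cvg]; the second is
    the domination needed there. Kernels built from [W] at moving points [x_ k]
    all have this form, whether differentiated or differenced. *)
Definition kernel_limit (K : nat -> E -> R) (Kl : E -> R) (t_ : nat -> R) :=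
  (forall y (z : nat -> E), z k @[k --> \oo] --> y ->
    K k (z k) @[k --> \oo] --> Kl y) /\
  exists g : E -> R, exists2 del : R, 0 < del & integrable_on_space g /\
    \forall k \near \oo, forall y z, `|z - y| <= del ->
      `|K k z * rho (t_ k) y| <= g y.

Section limits.
Variables (t_ : nat -> R) (t : R).
Hypothesis t_ab : forall k, a <= t_ k <= b.
Hypothesis tab : a <= t <= b.
Hypothesis t_cvg : t_ k @[k --> \oo] --> t.

Let rho_cvg y : rho (t_ k) y @[k --> \oo] --> rho t y.
Proof. by apply: (@rho_partial_cvg R d rho T rho_smooth [::] t_ (fun=> y) t y
  (time_range tab)) => //; exact: cvg_cst. Qed.

Lemma lattice_kernel_cvg (L : nat -> lattice R d) K Kl : refining L ->
  kernel_limit K Kl t_ ->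
  \sum_i K k (point i) * @cell_mass R d (L k) (rho (t_ k)) i @[k --> \oo] -->
  integral_on setT (fun y => Kl y * rho t y).
Proof.
move=> rL [cK [g [del del0 [ig gP]]]].
apply: (@lattice_sum_cvg R d L K (fun k => rho (t_ k)) Kl (rho t) g del) => //.
by move=> k; exact: rho_continuous.
Qed.

Lemma integral_kernel_cvg K Kl : (forall k, continuous (K k)) ->
  kernel_limit K Kl t_ ->
  integrable_on_space (fun y => Kl y * rho t y) /\
  integral_on setT (fun y => K k y * rho (t_ k) y) @[k --> \oo] -->
  integral_on setT (fun y => Kl y * rho t y).
Proof.
move=> contK [cK [g [del del0 [ig gP]]]].
apply: (@integral_on_dominated _ _ (fun k y => K k y * rho (t_ k) y) _ g) => //.
- apply: nearW => k; apply: (@measurable_vec_continuous R d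
  (fun y => K k y * rho (t_ k) y)).
  by apply: continuous_fun_mul; [exact: contK|exact: rho_continuous].
- by move=> y; apply: cvgM => //; apply: cK; exact: cvg_cst.
- by apply: filterS gP => k gk y; apply: gk; rewrite subrr normr0 ltW.
Qed.

(** The domination hypothesis is local in [x]; it is used on the ball of radius
    [|x| + 1], which eventually contains the ball of radius 1/2 around [x_ k].
    *)
Lemma near_dominated (x_ : nat -> E) (x : E) (s : seq 'I_d) :
  (size s <= 2)%N -> x_ k @[k --> \oo] --> x ->
  exists g : E -> R, exists2 del : R, 0 < del & integrable_on_space g /\
    \forall k \near \oo, forall x' y z, `|x' - x_ k| <= 2^-1 ->
      `|z - y| <= del -> `|W_partial W s x' z * rho (t_ k) y| <= g y.
Proof.
move=> s2 xx; have [g [del del0 [ig gP]]] := dom (`|x| + 1).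
exists g, del => //; split=> //.
have e0 : 0 < 2^-1 :> R by rewrite invr_gt0.
have /cvgrPdist_le/(_ _ e0) := xx; apply: filterS => k xk x' y z x'k zy.
rewrite normrM (gtr0_norm (rho_gt0 _ (time_range (t_ab k)))).
apply: (gP s (t_ k) x' y z s2 (t_ab k) _ zy).
have -> : x' = x' - x_ k - (x - x_ k) + x by rewrite opprB addrA subrK subrK.
rewrite (le_trans (ler_normD _ _))// addrC lerD2l (le_trans (ler_normB _ _))//.
by rewrite (le_trans (lerD x'k xk))//; lra.
Qed.

Lemma point_kernel_limit (x_ : nat -> E) (x : E) s : (size s <= 2)%N ->
  x_ k @[k --> \oo] --> x ->
  kernel_limit (fun k => W_partial W s (x_ k)) (W_partial W s x) t_.
Proof.
move=> s2 xx; split=> [y z zy|]; first exact: W_partial_cvg.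
have [g [del del0 [ig gP]]] := @near_dominated x_ x s s2 xx.
exists g, del => //; split=> //; apply: filterS gP => k gk y z.
by apply: (gk (x_ k) y z); rewrite subrr normr0.
Qed.

Lemma small_step (h_ : nat -> R) (v : 'I_d) : h_ k @[k --> \oo] --> 0 ->
  \forall k \near \oo, forall s : R, `|s| <= 3 * `|h_ k| ->
    `|s *: basis_vec R v| <= 2^-1.
Proof.
have e0 : 0 < 6^-1 :> R by rewrite invr_gt0.
move=> /cvgrPdist_le/(_ _ e0); apply: filterS => k.
rewrite sub0r normrN => hk s sh; rewrite normrZ.
rewrite (le_trans (ler_wpM2l _ (basis_vec_norm v)))// mulr1; lra.
Qed.

(** By the mean value theorem a difference quotient is a derivative at a nearby
    point, so it obeys the same domination. *)
Lemma quotient_kernel_limit (x_ : nat -> E) (x : E) (h_ : nat -> R) s v :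
  (size s <= 1)%N -> x_ k @[k --> \oo] --> x ->
  h_ k @[k --> \oo] --> 0 -> (forall k, h_ k != 0) ->
  kernel_limit (fun k z =>
    (W_partial W s (x_ k + h_ k *: basis_vec R v) z - W_partial W s (x_ k) z)
      / h_ k)
    (W_partial W (v :: s) x) t_.
Proof.
move=> s1 xx h0 hn0; split=> [y z zy|]; first exact: W_partial_quotient_cvg.
have [g [del del0 [ig gP]]] := @near_dominated x_ x (v :: s) s1 xx.
exists g, del => //; split=> //.
apply: filterS2 (small_step v h0) gP => k hk gk y z zy.
have [|u uh ->] := @mean_value_line R E (W_partial W s ^~ z) (x_ k)
  (basis_vec R v) (h_ k).
  by move=> u _; exact: W_partial_derivable.
rewrite [_ * _ / h_ k]mulrAC divff// mul1r.
apply: (gk (x_ k + u *: basis_vec R v)) => //.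
rewrite addrAC subrr add0r; apply: hk; rewrite (le_trans uh)//.
by have : 0 <= `|h_ k| by []; lra.
Qed.

Lemma second_kernel_limit (x_ : nat -> E) (x : E) (h_ : nat -> R) v :
  x_ k @[k --> \oo] --> x ->
  h_ k @[k --> \oo] --> 0 -> (forall k, h_ k != 0) ->
  kernel_limit (fun k z => (W (x_ k + h_ k *: basis_vec R v) z
      - 2 * W (x_ k) z + W (x_ k - h_ k *: basis_vec R v) z) / h_ k ^+ 2)
    (W_partial W [:: v; v] x) t_.
Proof.
move=> xx h0 hn0; split=> [y z zy|]; first exact: W_partial_second_cvg.
have [g [del del0 [ig gP]]] := @near_dominated x_ x [:: v; v] erefl xx.
exists g, del => //; split=> //.
apply: filterS2 (small_step v h0) gP => k hk gk y z zy.
have [|u uh ->] := @second_mean_value_line R E (W ^~ z) (x_ k) (basis_vec R v)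
  (h_ k).
  move=> u _; split.
    exact: (@W_partial_derivable _ _ _ W_smooth [::]).
  exact: (@W_partial_derivable _ _ _ W_smooth [:: v]).
rewrite [_ * _ / h_ k ^+ 2]mulrAC divff ?expf_neq0// mul1r.
apply: (gk (x_ k + u *: basis_vec R v)) => //.
by rewrite addrAC subrr add0r; apply: hk.
Qed.

End limits.

(** For [s] empty this is the interaction part of the potential; in general it
    is the derivative of this part along [s], by [interaction_derive]. *)
Definition interaction s t x :=
  integral_on setT (fun y => W_partial W s x y * rho t y).

Lemma W_partial_continuous_snd s x : continuous (W_partial W s x).
Proof. by move=> y; apply: continuous_seq => q qy; apply: W_partial_cvg => //;
  exact: cvg_cst. Qed.

Lemma interaction_cvg s (t_ : nat -> R) t (x_ : nat -> E) x : (size s <= 2)%N ->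
  (forall k, a <= t_ k <= b) -> a <= t <= b -> t_ k @[k --> \oo] --> t ->
  x_ k @[k --> \oo] --> x ->
    interaction s (t_ k) (x_ k) @[k --> \oo] --> interaction s t x.
Proof.
move=> s2 t_ab tab tt xx.
apply: (integral_kernel_cvg t_ab tab tt _ (point_kernel_limit t_ab s2 xx)).2.
by move=> k; exact: W_partial_continuous_snd.
Qed.

Lemma interaction_integrable s t x : (size s <= 2)%N -> a <= t <= b ->
  integrable_on_space (fun y => W_partial W s x y * rho t y).
Proof.
move=> s2 tab; have t_ab (k : nat) : a <= t <= b by [].
have ct : (t : R) @[k --> \oo] --> t by exact: cvg_cst.
have cx : x @[k --> \oo] --> x by exact: cvg_cst.
apply: (integral_kernel_cvg t_ab tab ct _ (point_kernel_limit t_ab s2 cx)).1.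
by move=> k; exact: W_partial_continuous_snd.
Qed.

(** Differentiation under the integral sign: the difference quotients of [W]
    form a dominated kernel with the derivative as its limit. *)
Lemma interaction_derive s v t x : (size s <= 1)%N -> a <= t <= b ->
  is_derive x (basis_vec R v) (interaction s t) (interaction (v :: s) t x).
Proof.
move=> s1 tab; apply: is_derive_seq => h hn0 h0.
have t_ab (k : nat) : a <= t <= b by [].
have ct : (t : R) @[k --> \oo] --> t by exact: cvg_cst.
have cx : x @[k --> \oo] --> x by exact: cvg_cst.
have cK k : continuous (fun z =>
  (W_partial W s (x + h k *: basis_vec R v) z - W_partial W s x z) / h k).
  apply: continuous_fun_mul; last exact: continuous_fun_cst.
  by apply: continuous_fun_sub; exact: W_partial_continuous_snd.
have := (integral_kernel_cvg t_ab tab ct cK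
  (quotient_kernel_limit t_ab v s1 cx h0 hn0)).2.
move=> /eq_cvg_seq; apply => [//|k].
have s2 : (size s <= 2)%N by rewrite (leq_trans s1).
have i1 := interaction_integrable (x + h k *: basis_vec R v) s2 tab.
have i2 := interaction_integrable x s2 tab.
rewrite /interaction /integral_on preimage_setT -RintegralB// -RintegralZr//;
  last first.
  rewrite (_ : _ \o _ = (fun
    y => (W_partial W s (x + h k *: basis_vec R v) (vec y) * rho t
    (vec y))%:E) \-
    (fun y => (W_partial W s x (vec y) * rho t (vec y))%:E))%E//.
  exact: integrableB.
by apply: eq_Rintegral => y _; rewrite -mulrBl mulrAC.
Qed.

End interaction_limits.

(** * Difference quotients of logarithms *)

Section logarithm.
Context {R : realType}.

Lemma ln1D_near (s : R) : `|s| <= 2^-1 -> `|ln (1 + s) - s| <= 2 * s ^+ 2.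
Proof.
rewrite ler_norml => /andP[s1 s2].
have p : 0 < 1 + s by lra.
have up : ln (1 + s) <= s.
  by rewrite -[leRHS]expRK ler_ln ?posrE ?expR_gt0// expR_ge1Dx.
have lo : s - s ^+ 2 / (1 + s) <= ln (1 + s).
  rewrite -[ln (1 + s)]opprK -lnV ?posrE// lerNr.
  rewrite -[leRHS]expRK ler_ln ?posrE ?expR_gt0 ?invr_gt0//.
  apply: le_trans (expR_ge1Dx _).
  by rewrite le_eqVlt; apply/orP; left; apply/eqP; field; lra.
have q : s ^+ 2 / (1 + s) <= 2 * s ^+ 2.
  by rewrite ler_pdivrMr//; have := sqr_ge0 s; nra.
by rewrite ler_norml; apply/andP; split; have := sqr_ge0 s; lra.
Qed.

(** The argument [e_ k * u_ k] may vanish, so the limit is taken through the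
    quadratic remainder estimate instead of the derivative of [ln] at 1. *)
Lemma ln1D_cvg (e_ u_ : nat -> R) (u : R) : e_ k @[k --> \oo] --> 0 ->
  (forall k, e_ k != 0) -> u_ k @[k --> \oo] --> u ->
  ln (1 + e_ k * u_ k) / e_ k @[k --> \oo] --> u.
Proof.
move=> e0 en0 uu.
have eu0 : e_ k * u_ k @[k --> \oo] --> 0 by rewrite -(mul0r u); apply: cvgM.
have c : 2 * (e_ k * u_ k) * u_ k @[k --> \oo] --> 0.
  rewrite -(mul0r u); apply: cvgM => //; rewrite -(mulr0 2).
  by apply: cvgM => //; exact: cvg_cst.
have d0 : ln (1 + e_ k * u_ k) / e_ k - u_ k @[k --> \oo] --> 0.
  apply/cvgrPdist_le => r r0.
  have h0 : 0 < 2^-1 :> R by rewrite invr_gt0.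
  have /cvgrPdist_le/(_ _ h0) := eu0; have /cvgrPdist_le/(_ _ r0) := c.
  apply: filterS2 => k; rewrite !sub0r !normrN => k1 k2.
  have -> : ln (1 + e_ k * u_ k) / e_ k - u_ k =
    (ln (1 + e_ k * u_ k) - e_ k * u_ k) / e_ k by field; exact: en0.
  rewrite normrM normfV ler_pdivrMr ?normr_gt0//.
  rewrite (le_trans (ln1D_near k2))//.
  have -> : 2 * (e_ k * u_ k) ^+ 2 = (2 * (e_ k * u_ k) * u_ k) * e_ k by ring.
  by rewrite (le_trans (ler_norm _))// normrM ler_wpM2r.
rewrite -[u]add0r (_ : (fun k => _) =
  (fun k => (ln (1 + e_ k * u_ k) / e_ k - u_ k) + u_ k)).
  exact: cvgD.
by apply/funext => k; rewrite subrK.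
Qed.

Lemma cvg_step (A0 A1 h : nat -> R) (r p : R) :
  h k @[k --> \oo] --> 0 -> (forall k, h k != 0) ->
  A0 k @[k --> \oo] --> r -> (A1 k - A0 k) / h k @[k --> \oo] --> p ->
  A1 k @[k --> \oo] --> r.
Proof.
move=> h0 hn0 c0 c1.
have : A0 k + h k * ((A1 k - A0 k) / h k) @[k --> \oo] --> r + 0 * p.
  by apply: cvgD => //; exact: cvgM.
rewrite mul0r addr0 => /eq_cvg_seq; apply => [//|k].
by rewrite mulrC divfK// addrC subrK.
Qed.

Lemma cvg_near_gt0 (A : nat -> R) (r : R) : 0 < r -> A k @[k --> \oo] --> r ->
  \forall k \near \oo, 0 < A k.
Proof. by move=> r0 /(cvgr_gt r); apply. Qed.

Lemma near_eq_cvg_seq (f g : nat -> R) (l : R) :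
  (\forall k \near \oo, f k = g k) -> f k @[k --> \oo] --> l ->
  g k @[k --> \oo] --> l.
Proof. by move=> fg; apply: cvg_trans; exact: near_eq_cvg. Qed.

(** The difference is the logarithm of [A1 k / A0 k = 1 + h k * u k], where [u
    k] tends to [p / r]. *)
Lemma ln_quotient_cvg (A0 A1 h : nat -> R) (r p : R) : 0 < r ->
  h k @[k --> \oo] --> 0 -> (forall k, h k != 0) ->
  A0 k @[k --> \oo] --> r -> (A1 k - A0 k) / h k @[k --> \oo] --> p ->
  (ln (A1 k) - ln (A0 k)) / h k @[k --> \oo] --> p / r.
Proof.
move=> r0 h0 hn0 c0 c1.
have c2 := cvg_step h0 hn0 c0 c1.
have cu : (A1 k - A0 k) / h k / A0 k @[k --> \oo] --> p / r.
  by apply: cvgM => //; apply: cvgV => //; rewrite gt_eqF.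
apply: near_eq_cvg_seq (ln1D_cvg h0 hn0 cu).
apply: filterS2 (cvg_near_gt0 r0 c0) (cvg_near_gt0 r0 c2) => k p0 p1.
congr (_ / _); rewrite -ln_div ?posrE//; congr ln.
by field; rewrite hn0 gt_eqF.
Qed.

(** The second difference of logarithms is the logarithm of [A1 * A2 / A0 ^+ 2
    = 1 + h ^+ 2 * u], where the mixed term of the product contributes the
    square of the first derivative: [u] tends to [q / r - (p / r) ^+ 2]. *)
Lemma ln_second_cvg (A0 A1 A2 h : nat -> R) (r p q : R) : 0 < r ->
  h k @[k --> \oo] --> 0 -> (forall k, h k != 0) ->
  A0 k @[k --> \oo] --> r -> (A1 k - A0 k) / h k @[k --> \oo] --> p ->
  (A1 k - 2 * A0 k + A2 k) / h k ^+ 2 @[k --> \oo] --> q ->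
  (ln (A1 k) - 2 * ln (A0 k) + ln (A2 k)) / h k ^+ 2 @[k --> \oo] -->
  q / r - (p / r) ^+ 2.
Proof.
move=> r0 h0 hn0 c0 c1 cq.
have c2 : (A2 k - A0 k) / h k @[k --> \oo] --> - p.
  have : h k * ((A1 k - 2 * A0 k + A2 k) / h k ^+ 2) - (A1 k - A0 k) / h k
      @[k --> \oo] --> 0 * q - p by apply: cvgB => //; exact: cvgM.
  rewrite mul0r sub0r => /eq_cvg_seq; apply => [//|k].
  by field; exact: hn0.
have hh0 : h k ^+ 2 @[k --> \oo] --> 0.
  by rewrite -(mul0r 0); under eq_fun do rewrite expr2; exact: cvgM.
have hhn0 k : h k ^+ 2 != 0 by rewrite expf_neq0.
have cu : (A1 k - 2 * A0 k + A2 k) / h k ^+ 2 / A0 k +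
    ((A1 k - A0 k) / h k / A0 k) * ((A2 k - A0 k) / h k / A0 k) @[k --> \oo] -->
    q / r + (p / r) * (- p / r).
  have iV : (A0 k)^-1 @[k --> \oo] --> r^-1 by apply: cvgV => //;
    rewrite gt_eqF.
  by apply: cvgD; [exact: cvgM|apply: cvgM; exact: cvgM].
rewrite (_ : _ - _ = q / r + (p / r) * (- p / r)); last first.
  by rewrite mulNr mulrN expr2.
apply: near_eq_cvg_seq (ln1D_cvg hh0 hhn0 cu).
apply: filterS3 (cvg_near_gt0 r0 c0) (cvg_near_gt0 r0 (cvg_step h0 hn0 c0 c1))
  (cvg_near_gt0 r0 (cvg_step h0 hn0 c0 c2)) => k p0 p1 p2.
congr (_ / _).
have -> : ln (A1 k) - 2 * ln (A0 k) + ln (A2 k) =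
    ln (A1 k * A2 k / (A0 k * A0 k)).
  rewrite ln_div ?posrE ?mulr_gt0// !lnM ?posrE//; ring.
congr ln; field; rewrite hn0 gt_eqF//.
Qed.

End logarithm.

(** * The exact potential and the exact current *)

Section solution.
Context {R : realType} {d : nat}.
Local Notation E := 'rV[R]_d.
Variables (V : E -> R) (W : E -> E -> R) (beta : R).
Variables (rho : R -> E -> R) (T a b : R).
Hypothesis V_smooth : smooth_on setT V.
Hypothesis W_smooth : smooth_on setT (fun p : E * E => W p.1 p.2).
Hypothesis sol : classical_solution V W beta T rho.
Hypothesis a_gt0 : 0 < a.
Hypothesis b_ltT : b < T.
Hypothesis dom : dominated_interaction W rho a b.

Let rho_smooth := solution_smooth sol.
Let rho_gt0 := solution_gt0 sol.

Lemma V_derivable s x v : derivable (partials s V) x (basis_vec R v).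
Proof. exact: (V_smooth _ Logic.I).2. Qed.

Lemma V_continuous s : continuous (partials s V).
Proof. by move=> x; exact: (@V_smooth _ x Logic.I).1. Qed.

Definition potential_derive s t x := partials s V x + interaction W rho s t x.

Lemma potential_is_derive s v t x : (size s <= 1)%N -> a <= t <= b ->
  is_derive x (basis_vec R v) (potential_derive s t)
    (potential_derive (v :: s) t x).
Proof.
move=> s1 tab.
have ? := interaction_derive W_smooth rho_smooth rho_gt0 a_gt0 b_ltT dom v x
  s1 tab.
have ? : is_derive x (basis_vec R v) (partials s V) (partials (v :: s) V x).
  by split=> //; exact: V_derivable.
exact: is_deriveD.
Qed.

Lemma derive_potential_derive s v t : (size s <= 1)%N -> a <= t <= b ->
  'D_(basis_vec R v) (potential_derive s t) = potential_derive (v :: s) t.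
Proof.
move=> s1 tab; apply/funext => x.
exact: (@derive_val _ _ _ _ _ _ _ (potential_is_derive v x s1 tab)).
Qed.

Lemma potential_derive_cvg s (t_ : nat -> R) t (x_ : nat -> E) x :
  (size s <= 2)%N ->
  (forall k, a <= t_ k <= b) -> a <= t <= b -> t_ k @[k --> \oo] --> t ->
  x_ k @[k --> \oo] --> x ->
  potential_derive s (t_ k) (x_ k) @[k --> \oo] --> potential_derive s t x.
Proof.
move=> s2 t_ab tab tt xx; apply: cvgD.
  exact: (cvg_comp x_ (partials s V) xx (@V_continuous s x)).
exact: (interaction_cvg W_smooth rho_smooth rho_gt0 a_gt0 b_ltT dom s2 t_ab tab
  tt xx).
Qed.

Lemma rho_is_derive s v t x : a <= t <= b ->
  is_derive x (basis_vec R v) (rho_partial rho s t)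
    (rho_partial rho (v :: s) t x).
Proof.
move=> tab; split=> //; apply: (rho_partial_derivable rho_smooth).
exact: (time_range a_gt0 b_ltT tab).
Qed.

(** The exact current with its derivatives computed, see [currentE]. *)
Definition flux_density v t x :=
  - (rho t x * potential_derive [:: v] t x + beta * rho_partial rho [:: v] t x).

Lemma currentE v t : a <= t <= b ->
  current V W beta (rho t) v = flux_density v t.
Proof.
move=> tab; apply/funext => x.
rewrite /current /drift_component; congr (- (_ * _ + _)).
exact: (congr1 (fun f => f x) (@derive_potential_derive [::] v t erefl tab)).
Qed.

Lemma flux_density_cvg v (t_ : nat -> R) t (x_ : nat -> E) x :
  (forall k, a <= t_ k <= b) -> a <= t <= b -> t_ k @[k --> \oo] --> t ->
  x_ k @[k --> \oo] --> x ->
  flux_density v (t_ k) (x_ k) @[k --> \oo] --> flux_density v t x.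
Proof.
move=> t_ab tab tt xx; have tT := time_range a_gt0 b_ltT tab.
apply: cvgN; apply: cvgD; apply: cvgM.
- exact: (@rho_partial_cvg R d rho T rho_smooth [::] t_ x_ t x tT).
- exact: (@potential_derive_cvg [:: v]).
- exact: cvg_cst.
- exact: (@rho_partial_cvg R d rho T rho_smooth [:: v] t_ x_ t x tT).
Qed.

Lemma flux_density_continuous v t : a <= t <= b ->
  continuous (flux_density v t).
Proof.
move=> tab x; apply: continuous_seq => q qx.
by apply: (@flux_density_cvg v (fun=> t)) => //; exact: cvg_cst.
Qed.

(** The product rule, applied to the drift of the equation. *)
Lemma equationE t x : a <= t <= b ->
  rho_rate rho t x = \sum_v (rho_partial rho [:: v] t x * potential_derive
    [:: v] t x
    + rho t x * potential_derive [:: v; v] t x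
      + beta * rho_partial rho [:: v; v] t x).
Proof.
move=> tab; have tT := time_range a_gt0 b_ltT tab.
rewrite /rho_rate -derive1E (solution_equation sol)// /laplacian mulr_sumr.
rewrite -big_split/=; apply: eq_bigr => v _; congr (_ + _).
have -> : drift_component V W (rho t) v =
    (fun x => rho_partial rho [::] t x * potential_derive [:: v] t x).
  apply/funext => y; rewrite /drift_component; congr (_ * _).
  exact: (congr1 (fun f => f y) (@derive_potential_derive [::] v t erefl tab)).
have ? := @rho_is_derive [::] v t x tab.
have ? := @potential_is_derive [:: v] v t x erefl tab.
transitivity (rho_partial rho [::] t x * potential_derive [:: v; v] t x +
    potential_derive [:: v] t x * rho_partial rho [:: v] t x).
  exact: (@derive_val _ _ _ _ _ _ _ (is_deriveM _ _)).
by rewrite [RHS]addrC [X in _ = _ + X]mulrC.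
Qed.

End solution.

(** * Cell averages of the density *)

Lemma continuous_shift_fun {R : realType} {U : normedModType R} (f : U -> R)
  (c : U) :
  continuous f -> continuous (fun z => f (z + c)).
Proof.
move=> cf z; apply: (continuous_comp (f := fun z => z + c)); last exact: cf.
exact: continuous_addr.
Qed.

Section cell_averages.
Context {R : realType} {d : nat}.
Local Notation E := 'rV[R]_d.
Variables (rho : R -> E -> R) (T : R).
Hypothesis rho_smooth : smooth_on [set p : R^o * E | 0 < p.1 < T]
  (fun p => rho p.1 p.2).

Lemma rho_continuous_at t : 0 < t < T -> continuous (rho t).
Proof. by move=> tT; exact: (@rho_partial_continuous R d rho T rho_smooth [::] t
  tT). Qed.

(** The cell mass as a function of an arbitrary centre, so that neighbouring
    cells are translates of each other. *)
Definition cube_mass h t y := integral_on (cube y h) (rho t).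

Lemma cube_massB h t y c : 0 <= h -> 0 < t < T ->
  cube_mass h t (y + c) - cube_mass h t y =
  integral_on (cube y h) (fun z => rho t (z + c) - rho t z).
Proof.
move=> h0 tT; have cr := rho_continuous_at tT.
rewrite /cube_mass integral_on_shift// -[- integral_on _ _]mulN1r
  -integral_on_cubeZ//.
rewrite -integral_on_cubeD//; last 2 first.
- exact: continuous_shift_fun.
- by apply: continuous_fun_mul => //; exact: continuous_fun_cst.
by congr (integral_on _ _); apply/funext => z; rewrite mulN1r.
Qed.

Variables (t_ : nat -> R) (t : R) (x_ : nat -> E) (x : E) (h : nat -> R).
Hypothesis t_in : forall k, 0 < t_ k < T.
Hypothesis t_lim : 0 < t < T.
Hypothesis t_cvg : t_ k @[k --> \oo] --> t.
Hypothesis x_cvg : x_ k @[k --> \oo] --> x.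
Hypothesis h_gt0 : forall k, 0 < h k.
Hypothesis h_cvg : h k @[k --> \oo] --> 0.

Lemma average_cvg :
  cube_mass (h k) (t_ k) (x_ k) / h k ^+ d @[k --> \oo] --> rho t x.
Proof.
apply: (@cube_average_cvg R d (fun k => rho (t_ k)) x_ x h) => //.
- by move=> k; exact: rho_continuous_at.
- by move=> z zx; exact: (@rho_partial_cvg R d rho T rho_smooth [::] t_ z t x).
Qed.

(** The quotient is the average over one cell of the difference quotients of
    the density. *)
Lemma average_quotient_cvg v (e : nat -> R) : e k @[k --> \oo] --> 0 ->
  (forall k, e k != 0) ->
  (cube_mass (h k) (t_ k) (x_ k + e k *: basis_vec R v) / h k ^+ d
   - cube_mass (h k) (t_ k) (x_ k) / h k ^+ d) / e k
   @[k --> \oo] --> rho_partial rho [:: v] t x.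
Proof.
move=> e0 en0.
have cD k : continuous (fun z : E => rho (t_ k) (z + e k *: basis_vec R v)
  - rho (t_ k) z).
  have cr := rho_continuous_at (t_in k).
  by apply: continuous_fun_sub => //; exact: continuous_shift_fun.
have := @cube_average_cvg R d (fun k (z : E) =>
  (e k)^-1 * (rho (t_ k) (z + e k *: basis_vec R v) - rho (t_ k) z))
  x_ x h (rho_partial rho [:: v] t x) h_gt0 h_cvg x_cvg.
move=> /(_ _ _)/eq_cvg_seq; apply => [k|z zx||k] //.
- by apply: continuous_fun_mul => //; exact: continuous_fun_cst.
- have := @rho_quotient_cvg R d rho T rho_smooth v t_ z e t x t_lim t_cvg zx
  e0 en0.
  move=> /eq_cvg_seq; apply => [//|k].
  exact: mulrC.
- rewrite integral_on_cubeZ ?ltW// -cube_massB ?ltW//.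
  by field; rewrite en0 expf_neq0// gt_eqF.
Qed.

Lemma average_second_cvg v (e : nat -> R) : e k @[k --> \oo] --> 0 ->
  (forall k, e k != 0) ->
  (cube_mass (h k) (t_ k) (x_ k + e k *: basis_vec R v) / h k ^+ d
   - 2 * (cube_mass (h k) (t_ k) (x_ k) / h k ^+ d)
   + cube_mass (h k) (t_ k) (x_ k - e k *: basis_vec R v) / h k ^+ d) / e k ^+ 2
   @[k --> \oo] --> rho_partial rho [:: v; v] t x.
Proof.
move=> e0 en0.
have cD k c : continuous (fun z : E => rho (t_ k) (z + c) - rho (t_ k) z).
  have cr := rho_continuous_at (t_in k).
  by apply: continuous_fun_sub => //; exact: continuous_shift_fun.
have := @cube_average_cvg R d (fun k (z : E) => (e k ^+ 2)^-1 *
  ((rho (t_ k) (z + e k *: basis_vec R v) - rho (t_ k) z) +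
   (rho (t_ k) (z + - (e k *: basis_vec R v)) - rho (t_ k) z)))
  x_ x h (rho_partial rho [:: v; v] t x) h_gt0 h_cvg x_cvg.
move=> /(_ _ _)/eq_cvg_seq; apply => [k|z zx||k] //.
- apply: continuous_fun_mul; first exact: continuous_fun_cst.
  exact: continuous_fun_add.
- have := @rho_second_cvg R d rho T rho_smooth v t_ z e t x t_lim t_cvg zx
  e0 en0.
  move=> /eq_cvg_seq; apply => [//|k].
  by rewrite mulrC; congr (_ * _); ring.
- rewrite integral_on_cubeZ ?ltW//; last exact: continuous_fun_add.
  rewrite integral_on_cubeD ?ltW// -!cube_massB ?ltW//.
  by field; rewrite en0 expf_neq0// gt_eqF.
Qed.

Lemma average_time_cvg :
  integral_on (cube (x_ k) (h k)) (rho_rate rho (t_ k)) / h k ^+ d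
    @[k --> \oo] --> rho_rate rho t x.
Proof.
apply: (@cube_average_cvg R d (fun k => rho_rate rho (t_ k)) x_ x h) => //.
- by move=> k; exact: (rho_rate_continuous rho_smooth).
- by move=> z zx; exact: (rho_rate_cvg rho_smooth).
Qed.

End cell_averages.

Section mass_rate.
Context {R : realType} {d : nat}.
Local Notation E := 'rV[R]_d.
Variables (rho : R -> E -> R) (T : R).
Hypothesis rho_smooth : smooth_on [set p : R^o * E | 0 < p.1 < T]
  (fun p => rho p.1 p.2).

(** Differentiation under the integral sign; the time derivative is bounded on
    a compact neighbourhood of [t] times the cell. *)
Lemma derive_cube_mass (c : E) (h t : R) : 0 <= h -> 0 < t < T ->
  derive1 (fun s => integral_on (cube c h) (rho s)) t =
  integral_on (cube c h) (rho_rate rho t).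
Proof.
move=> h0 tT.
pose del := Num.min t (T - t) / 2.
have del0 : 0 < del by rewrite divr_gt0// lt_min subr_gt0.
have near_t s : `|s - t| <= del -> 0 < s < T.
  have : del < t.
    rewrite /del; have : Num.min t (T - t) <= t by rewrite ge_min lexx.
    lra.
  have : del < T - t.
    rewrite /del; have : Num.min t (T - t) <= T - t by rewrite ge_min lexx orbT.
    have /andP[_ ?] := tT; lra.
  by rewrite ler_distl => ? ? /andP[? ?]; apply/andP; split; lra.
have [M HM] : exists M, forall s y, `|s - t| <= del -> cube c h y ->
    `|rho_rate rho s y| <= M.
  (* the mean value theorem in time needs a bound between [t] and [t + e k] *)
  pose A : set (R^o * E) := `[t - del, t + del]%classic `*` cube c h.
  have cA : compact A.
    apply: compact_setX; last exact: compact_cube.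
    exact: segment_compact.
  have : compact ((fun p : R^o * E => rho_rate rho p.1 p.2) @` A).
    apply: continuous_compact cA; apply: continuous_in_subspaceT => p.
    rewrite inE => -[/= p1 p2]; apply: (rho_rate_continuous2 rho_smooth).
    by apply: near_t; move: p1; rewrite in_itv/= ler_distl.
  move=> /compact_bounded[M [Mr HM]]; exists (M + 1) => s y sd cy.
  apply: (HM (M + 1)); first by rewrite ltrDl.
  by exists (s, y) => //; split=> //=; rewrite in_itv/= -ler_distl.
rewrite derive1E; apply: (@derive_val _ _ _ _ _ _ _ (is_derive_seq _)) => e
  en0 e0.
pose C := @vec R d @^-1` cube c h.
have cr s : `|s - t| <= del -> continuous (rho s).
  by move=> /near_t; exact: rho_continuous_at.
pose f_ k := (fun y => (rho (t + e k) y - rho t y) / e k) \_ (cube c h).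
pose f := (rho_rate rho t) \_ (cube c h).
have e_small : \forall k \near \oo, `|e k| <= del.
  have /cvgrPdist_le/(_ _ del0) := e0; apply: filterS => k.
  by rewrite sub0r normrN.
have mpatch (g : E -> R) : continuous g -> measurable_rV (g \_ (cube c h)).
  move=> cg; rewrite /measurable_rV.
  rewrite (_ : _ \o _ = (g \o @vec R d) \_ C); last first.
    by apply/funext => y; rewrite /= !patchE.
  apply/(measurable_restrictT _ (measurable_cube c h)).
  by apply: measurable_funTS; exact: measurable_vec_continuous.
have tt : `|t - t| <= del by rewrite subrr normr0 ltW.
have := @integral_on_dominated R d f_ f ((fun _ => M) \_ (cube c h)) _ _ _ _.
have IE (g : E -> R) : integral_on setT (g \_ (cube c h)) =
  integral_on (cube c h) g.
  rewrite /integral_on [RHS]Rintegral_mkcond preimage_setT.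
  by apply: eq_Rintegral => y _; rewrite !patchE.
move=> [].
- apply: filterS e_small => k ke; apply: mpatch.
  apply: continuous_fun_mul; last exact: continuous_fun_cst.
  apply: continuous_fun_sub; apply: cr => //.
  by rewrite addrAC subrr add0r.
- move=> y; rewrite /f_ /f; have [cy|ncy] := pselect (cube c h y).
    rewrite patchE mem_set//.
    have ct : (fun=> t) k @[k --> \oo] --> t by exact: cvg_cst.
    have cy' : (fun=> y) k @[k --> \oo] --> y by exact: cvg_cst.
    have := rho_time_quotient_cvg rho_smooth tT ct cy' e0 en0.
    by move=> /eq_cvg_seq; apply => [//|k]; rewrite patchE mem_set.
  rewrite patchE memNset//; apply: (near_eq_cvg_seq _ (cvg_cst 0)).
  by apply: nearW => k; rewrite patchE memNset.
- rewrite /integrable_on_space.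
  rewrite (_ : (fun y => _) = (EFin \o (cst M \o @vec R d)) \_ C); last first.
    apply/funext => y; rewrite /= !patchE.
    have -> : (vec y \in cube c h) = (y \in C) by apply/idP/idP; rewrite !inE.
    by case: ifP.
  apply/(integrable_restrict _ (measurable_cube c h) measurableT).
  by rewrite setTI; apply: integrable_cube => //; exact: continuous_fun_cst.
- apply: filterS e_small => k ke y; rewrite /f_ !patchE; case: ifPn => cy;
  last first.
    by rewrite normr0.
  have := @mean_value_line R R^o (rho ^~ y) t 1 (e k).
  have s1 (s : R) : (t : R^o) + s *: (1 : R^o) = t + s by rewrite [s *: _]mulr1.
  move=> [s se|s se].
    rewrite s1; apply: (rho_derivable_time rho_smooth); apply: near_t.
    by rewrite addrAC subrr add0r (le_trans se).
  rewrite !s1 => ->; rewrite mulrAC divff// mul1r.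
  apply: HM; last by move: cy; rewrite inE.
  by rewrite addrAC subrr add0r (le_trans se).
rewrite IE => _; apply: near_eq_cvg_seq.
apply: filterS e_small => k ke; rewrite IE.
have -> : (t : R^o) + e k *: (1 : R^o) = t + e k by rewrite [_ *: _]mulr1.
rewrite [RHS]mulrC -[- integral_on _ _]mulN1r.
rewrite -integral_on_cubeZ//; last exact: cr.
rewrite -integral_on_cubeD//; last 2 first.
- by apply: cr; rewrite addrAC subrr add0r.
- by apply: continuous_fun_mul; [exact: continuous_fun_cst|exact: cr].
rewrite -integral_on_cubeZ//.
  by congr (integral_on _ _); apply/funext => y; rewrite mulN1r mulrC.
apply: continuous_fun_add; first by apply: cr; rewrite addrAC subrr add0r.
by apply: continuous_fun_mul; [exact: continuous_fun_cst|exact: cr].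
Qed.

End mass_rate.

(** * The discrete energy gradient and the neighbours of a vertex *)

Section scheme_structure.
Context {R : realType} {d : nat}.
Local Notation E := 'rV[R]_d.
Implicit Types L : lattice R d.

Section energy.
Variables (V : E -> R) (W : E -> E -> R) (beta : R).
Hypothesis W_sym : forall x y, W x y = W y x.

(** As a function of the mass of [i] alone, the energy is a constant plus a
    quadratic polynomial plus [beta * (s * ln s)]. The symmetry of [W] merges
    the two off-diagonal contributions to the linear coefficient, which
    compensates the factor 1/2. *)
Lemma energy_gradientE L (m : vertex L -> R) (i : vertex L) : 0 < m i ->
  energy_gradient V W beta m i =
  V (point i) + \sum_j W (point i) (point j) * m j + beta * (ln (m i) + 1).
Proof.
move=> mi0; rewrite /energy_gradient.
pose c0 := \sum_(j | j != i) V (point j) * m j +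
  2^-1 * (\sum_(j | j != i) \sum_(k | k != i) W (point j) (point k) * m j *
    m k) +
  beta * \sum_(j | j != i) m j * ln (m j).
pose c1 := V (point i) + \sum_(j | j != i) W (point i) (point j) * m j.
have -> : (fun s => free_energy V W beta (fun j => if j == i then s else m j)) =
    cst c0 + c1 *: (id : R -> R)
      + (2^-1 * W (point i) (point i)) *: ((id : R -> R) * id)
      + beta *: ((id : R -> R) * (@ln R)).
  apply/funext => s; rewrite /free_energy.
  have upd (f : vertex L -> R) (g : vertex L -> R -> R) :
      \sum_j f j * g j (if j == i then s else m j) =
      f i * g i s + \sum_(j | j != i) f j * g j (m j).
    rewrite (bigD1 i)//= eqxx; congr (_ + _).
    by apply: eq_bigr => j /negbTE ->.
  have -> : \sum_j \sum_k W (point j) (point k) * (if j == i then s else m j) *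
      (if k == i then s else m k) =
    W (point i) (point i) * s * s
      + 2 * s * (\sum_(j | j != i) W (point i) (point j) * m j)
     + \sum_(j | j != i) \sum_(k | k != i) W (point j) (point k) * m j * m k.
    have inner j : \sum_k W (point j) (point k) * (if j == i then s else m j) *
      (if k == i then s else m k) =
      W (point j) (point i) * (if j == i then s else m j) * s +
      \sum_(k | k != i) W (point j) (point k) * (if j == i then s else m j)
        * m k.
      exact: (upd (fun k => W (point j) (point k) * _) (fun _ x => x)).
    under eq_bigr do rewrite inner.
    rewrite big_split/= (bigD1 i)//= eqxx.
    have -> : \sum_(j | j != i) W (point j) (point i) *
      (if j == i then s else m j) * s =
        s * (\sum_(j | j != i) W (point i) (point j) * m j).
      rewrite mulr_sumr; apply: eq_bigr => j /negbTE ->.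
      by rewrite W_sym mulrC.
    rewrite [X in _ + X](bigD1 i)//= eqxx.
    have -> : \sum_(k | k != i) W (point i) (point k) * s * m k =
        s * (\sum_(j | j != i) W (point i) (point j) * m j).
      by rewrite mulr_sumr; apply: eq_bigr => j _; ring.
    have -> : \sum_(j | j != i) \sum_(k | k != i) W (point j) (point k) *
        (if j == i then s else m j) * m k =
        \sum_(j | j != i) \sum_(k | k != i) W (point j) (point k) * m j * m k.
      by apply: eq_bigr => j /negbTE ->.
    ring.
  rewrite (upd (fun j => V (point j)) (fun _ x => x)).
  have -> : \sum_j (if j == i then s else m j) * ln
    (if j == i then s else m j) =
    s * ln s + \sum_(j | j != i) m j * ln (m j).
    rewrite (bigD1 i)//= eqxx; congr (_ + _).
    by apply: eq_bigr => j /negbTE ->.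
  rewrite /c0 /c1 /= !fctE /=.
  rewrite /GRing.scale /=; by field.
have d1 := is_derive_id (m i) (1 : R).
have D1 := is_deriveZ c1 d1.
have D2 := is_deriveZ (2^-1 * W (point i) (point i)) (is_deriveM d1 d1).
have D3 := is_deriveZ beta (is_deriveM d1 (is_derive1_ln mi0)).
have D := is_deriveD (is_deriveD (is_deriveD (is_derive_cst c0 (m i) 1) D1)
  D2) D3.
rewrite derive1E (@derive_val _ _ _ _ _ _ _ D).
rewrite (bigD1 i)//= /c1 /GRing.scale/= divff ?gt_eqF//.
by field.
Qed.

End energy.

(** Adjacency is expressed through indices, while the limits are taken through
    points of space; this lemma passes from one to the other. *)
Lemma successor_pointP L v (i j : vertex L) :
  successor v i j <-> point j = point i + spacing L *: basis_vec R v.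
Proof.
have h0 := spacing_gt0 L.
have bE u : (spacing L *: basis_vec R v) 0 u = spacing L * (u == v)%:R.
  by rewrite !mxE eqxx.
split.
  move=> /andP[/eqP jv /forall_inP ju]; apply/rowP => u.
  rewrite pointE [RHS]mxE pointE bE -addrA -mulrDr; congr (_ + _ * _).
  have [->|uv] := eqVneq u v; first by rewrite -jv -natr1.
  by rewrite addr0 (eqP (ju u uv)).
move=> /rowP pj.
have e u : (j u : nat) = (i u + (u == v))%N.
  have := pj u; rewrite pointE [X in _ = X -> _]mxE pointE bE -addrA -mulrDr
    -natrD => /addrI.
  by move=> /(mulfI (lt0r_neq0 h0))/eqP; rewrite eqr_nat => /eqP.
apply/andP; split; first by rewrite e eqxx addn1.
apply/forall_inP => u /negbTE uv; apply/eqP/val_inj => /=.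
by rewrite e uv addn0.
Qed.

(** Only vertices whose neighbours exist see the full divergence; covering a
    slightly larger ball guarantees this. *)
Lemma successor_exists L (i : vertex L) (v : 'I_d) (r : R) : `|point i| <= r ->
  (forall p : E, `|p| <= r + spacing L -> exists j : vertex L, cell j p) ->
  (exists j, successor v i j) /\ (exists j, successor v j i).
Proof.
move=> ir cov; have h0 := spacing_gt0 L.
have bE u : (spacing L *: basis_vec R v) 0 u = spacing L * (u == v)%:R.
  by rewrite !mxE eqxx.
have nb : `|spacing L *: basis_vec R v| <= spacing L.
  by rewrite normrZ gtr0_norm// ler_piMr ?(ltW h0)// basis_vec_norm.
split.
  have [||j pj] := @grid_vertex R d L (point i + spacing L *: basis_vec R v)
      (fun u => Posz (i u + (u == v))).
  - by move=> u; rewrite [LHS]mxE bE pointE -addrA -mulrDr -natrD.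
  - by apply: cov; rewrite (le_trans (ler_normD _ _))// lerD.
  - by exists j; apply/successor_pointP.
have [||j pj] := @grid_vertex R d L (point i - spacing L *: basis_vec R v)
    (fun u => (i u)%:Z - (u == v)%:Z).
- by move=> u; rewrite [LHS]mxE [X in _ + X]mxE bE pointE -addrA -mulrBr
  rmorphB.
- by apply: cov; rewrite (le_trans (ler_normB _ _))// lerD.
- by exists j; apply/successor_pointP; rewrite pj subrK.
Qed.

(** An edge changes exactly one coordinate, by one. *)
Lemma adjacent_sum L (i : vertex L) (f : vertex L -> R)
    (ip im : 'I_d -> vertex L) :
  (forall v, successor v i (ip v)) -> (forall v, successor v (im v) i) ->
  \sum_(j | adjacent i j) f j = \sum_v (f (ip v) + f (im v)).
Proof.
move=> Hp Hm.
pose P (v : 'I_d) (j : vertex L) :=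
  path_edge (i v) (j v) && [forall (u | u != v), i u == j u].
have Puniq v w j : P v j -> P w j -> v = w.
  move=> /andP[pv _] /andP[_ /forall_inP pw]; apply/eqP/negPn/negP => vw.
  have /eqP e := pw v vw; move: pv; rewrite /path_edge e.
  by case/orP => /eqP; lia.
transitivity (\sum_j \sum_(v | P v j) f j).
  rewrite big_mkcond/=; apply: eq_bigr => j _.
  case: ifPn => [/existsP[v vP]|nj].
    rewrite (bigD1 v)//= big1 ?addr0// => w /andP[wP wv].
    by rewrite (Puniq _ _ _ wP vP) eqxx in wv.
  rewrite big1// => v vP; case/negP: nj; apply/existsP; by exists v.
rewrite (exchange_big_dep predT)//=; apply: eq_bigr => v _.
have eqP_vertex (j k : vertex L) : (j v = k v :> nat) ->
    (forall u, u != v -> i u = j u) -> (forall u, u != v -> i u = k u) -> j = k.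
  move=> e Hj Hk; apply/ffunP => u; have [->|uv] := eqVneq u v;
    first exact: val_inj.
  by rewrite -Hj// -Hk.
have [/eqP pv /forall_inP pu] := andP (Hp v).
have [/eqP mv /forall_inP mu] := andP (Hm v).
have pu' u : u != v -> i u = ip v u by move=> uv; exact/eqP/pu.
have mu' u : u != v -> i u = im v u by move=> uv; apply/esym/eqP/mu.
have pP : P v (ip v).
  apply/andP; split; first by rewrite /path_edge pv eqxx.
  by apply/forall_inP => u uv; exact/eqP/pu'.
have mP : P v (im v).
  apply/andP; split; first by rewrite /path_edge mv eqxx orbT.
  by apply/forall_inP => u uv; exact/eqP/mu'.
have pm : im v != ip v by apply/eqP => e; move: pv mv; rewrite e; lia.
rewrite (bigD1 (ip v))//= (bigD1 (im v)) ?mP//= big1 ?addr0//.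
move=> j /andP[/andP[/andP[je /forall_inP ju] jp] jm].
have ju' u : u != v -> i u = j u by move=> uv; exact/eqP/ju.
case/orP: je => /eqP je.
- by move/eqP: jp; case; apply: eqP_vertex => //; rewrite -pv.
- by move/eqP: jm; case; apply: eqP_vertex => //; move: mv; rewrite -je => -[].
Qed.

End scheme_structure.

(** * The upwind flux and the faces of a cell *)

Section upwind.
Context {R : realType} {d : nat}.
Local Notation E := 'rV[R]_d.
Variables (V : E -> R) (W : E -> E -> R) (beta : R).

(** The rate of transfer from [i] to [j]; at most one of the two terms is
    nonzero, according to the sign of the difference of energy gradients. *)
Definition upwind_flux (L : lattice R d) (m : vertex L -> R)
  (i j : vertex L) : R :=
  let F := energy_gradient V W beta m in
  (spacing L ^+ 2)^-1 * (m i * Num.max (F i - F j) 0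
    - m j * Num.max (F j - F i) 0).

Lemma upwind_flux_antisym (L : lattice R d) m (i j : vertex L) :
  upwind_flux m i j = - upwind_flux m j i.
Proof. by rewrite /upwind_flux -[RHS]mulrN opprB. Qed.

Lemma scheme_upwind_flux (L : lattice R d) m (i : vertex L) :
  fokker_planck_scheme V W beta m i =
    - \sum_(j | adjacent i j) upwind_flux m i j.
Proof.
rewrite /fokker_planck_scheme /upwind_flux mulrBr !mulr_sumr -sumrB -sumrN.
by apply: eq_bigr => j _; ring.
Qed.

(** The upwind flux is a centred flux plus a numerical viscosity, the term with
    the absolute value. *)
Lemma upwindE (p q x : R) : p * Num.max (- x) 0 - q * Num.max x 0 =
  - ((p + q) / 2 * x + (q - p) / 2 * `|x|).
Proof.
have [x0|x0] := lerP 0 x.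
  by rewrite (@max_r _ _ (- x)) ?oppr_le0// ger0_norm//; field.
rewrite (@max_l _ _ (- x)) ?oppr_ge0 ?(ltW x0)// ltr0_norm//.
by field.
Qed.

End upwind.

Section face.
Context {R : realType} {d : nat}.
Local Notation E := 'rV[R]_d.

(** The position of a cell within the hyperplane of a face orthogonal to the
    direction [v]. *)
Definition row_except (v : 'I_d) (x : E) : 'rV[R]_d.-1 := \row_u x 0 (lift v u).

Lemma insert_coordK v (x : E) : insert_coord v (x 0 v) (row_except v x) = x.
Proof.
apply/rowP => u; rewrite mxE; case: (unliftP v u) => [u' ->|-> //].
by rewrite mxE.
Qed.

Lemma insert_coord_dist v (s s' : R) (z z' : 'rV[R]_d.-1) :
  `|insert_coord v s z - insert_coord v s' z'| <= `|s - s'| + `|z - z'|.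
Proof.
apply/rV_normP => [|u]; first by rewrite addr_ge0.
rewrite !mxE; case: (unliftP v u) => [u' _|_]; last by rewrite lerDl.
rewrite (le_trans _ (_ : `|z - z'| <= _)) ?lerDr//.
have := (rV_normP (z - z') (normr_ge0 (z - z'))).1 (lexx _) u'.
by rewrite !mxE.
Qed.

Lemma row_except_dist v (x x' : E) :
  `|row_except v x - row_except v x'| <= `|x - x'|.
Proof.
apply/rV_normP => // u; have :=
  (rV_normP (x - x') (normr_ge0 (x - x'))).1 (lexx _) (lift v u).
by rewrite !mxE.
Qed.

Lemma cvg_le_dist (U : normedModType R) (f : nat -> U) (l : U) (g : nat -> R) :
  g k @[k --> \oo] --> 0 -> (forall k, `|l - f k| <= g k) ->
    f k @[k --> \oo] --> l.
Proof.
move=> g0 fg; apply/cvgrPdist_le => e e0.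
have /cvgrPdist_le/(_ _ e0) := g0; apply: filterS => k.
by rewrite sub0r normrN => gk;
  rewrite (le_trans (fg k))// (le_trans (ler_norm _)).
Qed.

Lemma cvg_dist0 (U : normedModType R) (f : nat -> U) (l : U) :
  f k @[k --> \oo] --> l -> `|l - f k| @[k --> \oo] --> 0.
Proof.
move=> fl; have : `|l - f k| @[k --> \oo] --> `|l - l|.
  by apply: cvg_norm; apply: cvgB => //; exact: cvg_cst.
by rewrite subrr normr0.
Qed.

Lemma insert_coord_cvg v (s_ : nat -> R) (z_ : nat -> 'rV[R]_d.-1) s z :
  s_ k @[k --> \oo] --> s -> z_ k @[k --> \oo] --> z ->
  insert_coord v (s_ k) (z_ k) @[k --> \oo] --> insert_coord v s z.
Proof.
move=> cs cz.
apply: (@cvg_le_dist _ _ _ (fun k => `|s - s_ k| + `|z - z_ k|)).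
  by rewrite -[0]addr0; apply: cvgD; exact: cvg_dist0.
by move=> k; exact: insert_coord_dist.
Qed.

Lemma coord_cvg v (x_ : nat -> E) (x : E) : x_ k @[k --> \oo] --> x ->
  x_ k 0 v @[k --> \oo] --> x 0 v.
Proof.
move=> cx; apply: (@cvg_le_dist R^o _ _ _ (cvg_dist0 cx)) => k.
have := (rV_normP (x - x_ k) (normr_ge0 _)).1 (lexx _) v.
by rewrite !mxE.
Qed.

Lemma row_except_cvg v (x_ : nat -> E) (x : E) : x_ k @[k --> \oo] --> x ->
  row_except v (x_ k) @[k --> \oo] --> row_except v x.
Proof.
move=> cx; apply: (@cvg_le_dist _ _ _ _ (cvg_dist0 cx)) => k.
exact: row_except_dist.
Qed.

Lemma face_integralE (L : lattice R d) (i : vertex L) v f :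
  face_integral i v f = integral_on (cube (row_except v (point i)) (spacing L))
    (fun z => f (insert_coord v (point i 0 v + spacing L / 2) z)).
Proof.
rewrite /face_integral; congr (integral_on _ _).
by apply/seteqP; split=> z /= H u; have := H u; rewrite [row_except v _ 0 u]mxE.
Qed.

End face.

(** * Consistency along one sequence of lattices *)

Section sequence_algebra.
Context {R : realType}.
Implicit Types f g : nat -> R.

(** Limit laws in the pointwise form that matches statements about explicit
    sequences. *)
Lemma cvg_seqD f g (l l' : R) : f k @[k --> \oo] --> l ->
  g k @[k --> \oo] --> l' -> f k + g k @[k --> \oo] --> l + l'.
Proof. exact: cvgD. Qed.

Lemma cvg_seqM f g (l l' : R) : f k @[k --> \oo] --> l ->
  g k @[k --> \oo] --> l' -> f k * g k @[k --> \oo] --> l * l'.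
Proof. exact: cvgM. Qed.

Lemma cvg_seq_norm f (l : R) : f k @[k --> \oo] --> l ->
  `|f k| @[k --> \oo] --> `|l|.
Proof. exact: cvg_norm. Qed.

Lemma cvg_seq_sum (I : Type) (s : seq I) (f : I -> nat -> R) (l : I -> R) :
  (forall i, f i k @[k --> \oo] --> l i) ->
  \sum_(i <- s) f i k @[k --> \oo] --> \sum_(i <- s) l i.
Proof.
move=> fl; elim: s => [|i s IH].
  by rewrite big_nil; under eq_fun do rewrite big_nil; exact: cvg_cst.
by rewrite big_cons; under eq_fun do rewrite big_cons; exact: cvgD.
Qed.

Lemma diff_quotient_split (p1 p0 l1 l0 e c : R) :
  (p1 - p0) / e + c * ((l1 - l0) / e) = (p1 + c * l1 - (p0 + c * l0)) / e.
Proof. ring. Qed.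

Lemma second_diff_split (p1 p0 p2 l1 l0 l2 e c : R) :
  (p1 - 2 * p0 + p2) / e + c * ((l1 - 2 * l0 + l2) / e) =
  (p1 + c * l1 - 2 * (p0 + c * l0) + (p2 + c * l2)) / e.
Proof. ring. Qed.

Lemma transfer_split (a0 a1 y n h : R) : h != 0 ->
  (a0 + a1) * 2^-1 * (y / h) + h * ((a1 - a0) / h) * (2^-1 * (n / h)) =
  ((a0 + a1) / 2 * y + (a1 - a0) / 2 * n) / h.
Proof. by move=> hn0; field. Qed.

(** The two transfers at a vertex, divided by [h ^+ 2], as a combination of
    first and second difference quotients. The viscosity of the two faces
    enters with opposite signs and cancels in the limit, which is why a scheme
    that is only first-order accurate at the faces is still consistent. *)
Lemma balance_split (a0 a1 a2 g0 g1 g2 n1 n2 h : R) : h != 0 ->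
  a0 * ((g1 - 2 * g0 + g2) / h ^+ 2) +
  ((a1 - a0) / h * ((g1 - g0) / h) * 2^-1 +
   (a2 - a0) / - h * ((g2 - g0) / - h) * 2^-1 +
   ((a1 - a0) / h * (n1 / h) * 2^-1 + (a2 - a0) / - h * (n2 / h) * (- 2^-1))) =
  ((a0 + a1) / 2 * (g1 - g0) + (a1 - a0) / 2 * n1 +
   ((a0 + a2) / 2 * (g2 - g0) + (a2 - a0) / 2 * n2)) / h ^+ 2.
Proof. by move=> hn0; field. Qed.

Lemma log_split (p l k c : R) : p + c * (l + k + 1) = p + c * l + c * (k + 1).
Proof. ring. Qed.

Lemma upwind_shift (p q x y c : R) :
  p * Num.max (x + c - (y + c)) 0 - q * Num.max (y + c - (x + c)) 0 =
  - ((p + q) / 2 * (y - x) + (q - p) / 2 * `|y - x|).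
Proof.
have e u v : u + c - (v + c) = u - v by ring.
by rewrite !e -[x - y]opprB upwindE.
Qed.

Lemma flux_split (p q y n hd h : R) : h != 0 ->
  (h ^+ 2)^-1 * - ((p * hd + q * hd) / 2 * y + (q * hd - p * hd) / 2 * n) =
  - (hd / h ^+ 2 * ((p + q) / 2 * y + (q - p) / 2 * n)).
Proof. by move=> hn0; field. Qed.

Lemma face_split (tr f h hp : R) : h != 0 -> hp != 0 ->
  - (h * hp / h ^+ 2 * tr) - f = (0 - (tr / h + f / hp)) * hp.
Proof. by move=> hn0 hpn0; field; rewrite ?hn0 ?hpn0. Qed.

Lemma residual_split (f s hd : R) : hd != 0 ->
  f - hd * s = - (0 - (f / hd + - 1 * s)) * hd.
Proof. by move=> hn0; field. Qed.

(** In the limit the gradient of [beta * ln rho] multiplied by [rho] is [beta]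
    times the gradient of [rho]: the nonlinear terms cancel and leave linear
    diffusion. *)
Lemma balance_limit (r r1 r2 q1 q2 c : R) : r != 0 ->
  r1 * q1 + r * q2 + c * r2 -
  (r * (q2 + c * (r2 / r - (r1 / r) ^+ 2)) + r1 * (q1 + c * (r1 / r))) = 0.
Proof. by move=> rn0; field. Qed.

Lemma balance_fluxE (t1 t2 hd h : R) :
  - (- (hd / h * t1) + - (hd / h * t2)) = hd * ((t1 + t2) / h).
Proof. ring. Qed.

End sequence_algebra.

Section limit.
Context {R : realType} {d : nat}.
Local Notation E := 'rV[R]_d.
Variables (V : E -> R) (W : E -> E -> R) (beta : R).
Variables (rho : R -> E -> R) (T a b : R).
Hypothesis d_gt0 : (0 < d)%N.
Hypothesis V_smooth : smooth_on setT V.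
Hypothesis W_smooth : smooth_on setT (fun p : E * E => W p.1 p.2).
Hypothesis W_sym : forall x y, W x y = W y x.
Hypothesis sol : classical_solution V W beta T rho.
Hypothesis a_gt0 : 0 < a.
Hypothesis b_ltT : b < T.
Hypothesis dom : dominated_interaction W rho a b.
Variables (L : nat -> lattice R d) (t_ : nat -> R) (t : R).
Variables (i_ : forall k, vertex (L k)) (x : E).
Hypothesis L_refining : refining L.
Hypothesis t_ab : forall k, a <= t_ k <= b.
Hypothesis tab : a <= t <= b.
Hypothesis t_cvg : t_ k @[k --> \oo] --> t.
Hypothesis x_cvg : @Defs.point R d (L k) (i_ k) @[k --> \oo] --> x.

Let rho_smooth := solution_smooth sol.
Let rho_gt0 := solution_gt0 sol.
Let h k := spacing (L k).
Let x_ k : E := point (i_ k).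
Let m k := @cell_mass R d (L k) (rho (t_ k)).
(** The average density of a cell. *)
Let A k y := cube_mass rho (h k) (t_ k) y / h k ^+ d.
(** The discrete potential, defined at every point of space. *)
Let P k y := V y + \sum_j W y (@Defs.point R d (L k) j) * @m k j.
(** The energy gradient at a vertex is [G] up to a constant depending on [k]
    only, see [gradE]; fluxes involve differences of gradients, so [G] can
    replace it.  Unlike masses, averages have a positive limit. *)
Let G k y := P k y + beta * ln (A k y).
Let ev v : E := basis_vec R v.

Let h_gt0 k : 0 < h k. Proof. exact: spacing_gt0. Qed.
Let hn0 k : h k != 0. Proof. by rewrite gt_eqF. Qed.
Let h_cvg : h k @[k --> \oo] --> 0. Proof. by have [] := L_refining. Qed.
Let tT : 0 < t < T. Proof. exact: (time_range a_gt0 b_ltT tab). Qed.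
Let t_T k : 0 < t_ k < T. Proof. exact: (time_range a_gt0 b_ltT (t_ab k)). Qed.
Let r_gt0 : 0 < rho t x. Proof. exact: rho_gt0. Qed.

Let P_quot v (e : nat -> R) : e k @[k --> \oo] --> 0 -> (forall k, e k != 0) ->
  (P k (x_ k + e k *: ev v) - P k (x_ k)) / e k @[k --> \oo] -->
  potential_derive V W rho [:: v] t x.
Proof.
move=> e0 en0.
have c1 := @difference_quotient_cvg R E setT V (ev v) x x_ e openT Logic.I
  (fun y _ => @V_derivable R d V V_smooth [::] y v)
  (@V_continuous R d V V_smooth [:: v] x) x_cvg e0 en0.
have c2 := lattice_kernel_cvg rho_smooth a_gt0 b_ltT t_ab tab t_cvg L_refining
  (quotient_kernel_limit W_smooth rho_gt0 a_gt0 b_ltT dom t_ab v (s := [::]) isT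
    x_cvg e0 en0).
have := cvg_seqD c1 c2; move=> /eq_cvg_seq; apply => [//|k].
rewrite /P [X in _ = X / _](_ : _ = (V (x_ k + e k *: ev v) - V (x_ k)) +
  (\sum_j W (x_ k + e k *: ev v) (@Defs.point R d (L k) j) * @m k j -
   \sum_j W (x_ k) (@Defs.point R d (L k) j) * @m k j)); last by ring.
rewrite [RHS]mulrDl -sumrB mulr_suml; congr (_ + _).
by apply: eq_bigr => j _; rewrite -mulrBl [RHS]mulrAC.
Qed.

Let P_second v (e : nat -> R) : e k @[k --> \oo] --> 0 ->
  (forall k, e k != 0) ->
  (P k (x_ k + e k *: ev v) - 2 * P k (x_ k) + P k (x_ k - e k *: ev v)) / e
    k ^+ 2
    @[k --> \oo] --> potential_derive V W rho [:: v; v] t x.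
Proof.
move=> e0 en0.
have c1 := @second_difference_cvg R E setT V (ev v) x x_ e openT Logic.I
  (fun y _ => @V_derivable R d V V_smooth [::] y v)
  (fun y _ => @V_derivable R d V V_smooth [:: v] y v)
  (@V_continuous R d V V_smooth [:: v; v] x) x_cvg e0 en0.
have c2 := lattice_kernel_cvg rho_smooth a_gt0 b_ltT t_ab tab t_cvg L_refining
  (second_kernel_limit W_smooth rho_gt0 a_gt0 b_ltT dom t_ab v x_cvg e0 en0).
have := cvg_seqD c1 c2; move=> /eq_cvg_seq; apply => [//|k].
rewrite /P [X in _ = X / _](_ : _ =
  (V (x_ k + e k *: ev v) - 2 * V (x_ k) + V (x_ k - e k *: ev v)) +
  (\sum_j W (x_ k + e k *: ev v) (@Defs.point R d (L k) j) * @m k j -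
   2 * (\sum_j W (x_ k) (@Defs.point R d (L k) j) * @m k j)
   + \sum_j W (x_ k - e k *: ev v) (@Defs.point R d (L k) j) * @m k j));
     last by ring.
rewrite [RHS]mulrDl mulr_sumr -sumrB -big_split/= mulr_suml; congr (_ + _).
by apply: eq_bigr => j _; rewrite /m /x_ /ev; ring.
Qed.

Let A_cvg : A k (x_ k) @[k --> \oo] --> rho t x.
Proof. exact: (average_cvg rho_smooth t_T tT t_cvg x_cvg h_gt0 h_cvg). Qed.

Let A_quot v (e : nat -> R) : e k @[k --> \oo] --> 0 -> (forall k, e k != 0) ->
  (A k (x_ k + e k *: ev v) - A k (x_ k)) / e k @[k --> \oo] --> rho_partial rho
    [:: v] t x.
Proof.
exact: (@average_quotient_cvg R d rho T rho_smooth t_ t x_ x h t_T tT t_cvg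
  x_cvg h_gt0 h_cvg v e).
Qed.

Let A_second v (e : nat -> R) : e k @[k --> \oo] --> 0 ->
  (forall k, e k != 0) ->
  (A k (x_ k + e k *: ev v) - 2 * A k (x_ k) + A k (x_ k - e k *: ev v)) / e
    k ^+ 2
  @[k --> \oo] --> rho_partial rho [:: v; v] t x.
Proof.
exact: (@average_second_cvg R d rho T rho_smooth t_ t x_ x h t_T tT t_cvg x_cvg
  h_gt0 h_cvg v e).
Qed.

Let phi1 v := potential_derive V W rho [:: v] t x
  + beta * (rho_partial rho [:: v] t x / rho t x).
Let phi2 v := potential_derive V W rho [:: v; v] t x +
  beta * (rho_partial rho [:: v; v] t x / rho t x
    - (rho_partial rho [:: v] t x / rho t x) ^+ 2).

Let G_quot v (e : nat -> R) : e k @[k --> \oo] --> 0 -> (forall k, e k != 0) ->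
  (G k (x_ k + e k *: ev v) - G k (x_ k)) / e k @[k --> \oo] --> phi1 v.
Proof.
move=> e0 en0.
have c1 := ln_quotient_cvg r_gt0 e0 en0 A_cvg (@A_quot v e e0 en0).
have cb : (fun=> beta) k @[k --> \oo] --> beta by exact: cvg_cst.
have := cvg_seqD (@P_quot v e e0 en0) (cvg_seqM cb c1).
move=> /eq_cvg_seq; apply => [|k]; first exact: erefl.
exact: diff_quotient_split.
Qed.

Let G_second v (e : nat -> R) : e k @[k --> \oo] --> 0 ->
  (forall k, e k != 0) ->
  (G k (x_ k + e k *: ev v) - 2 * G k (x_ k) + G k (x_ k - e k *: ev v)) / e
    k ^+ 2
  @[k --> \oo] --> phi2 v.
Proof.
move=> e0 en0.
have c1 := ln_second_cvg r_gt0 e0 en0 A_cvg (@A_quot v e e0 en0)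
  (@A_second v e e0 en0).
have cb : (fun=> beta) k @[k --> \oo] --> beta by exact: cvg_cst.
have := cvg_seqD (@P_second v e e0 en0) (cvg_seqM cb c1).
move=> /eq_cvg_seq; apply => [|k]; first exact: erefl.
exact: second_diff_split.
Qed.

(** Minus the numerical flux between cells with centres [y0] and [y1], in the
    scaling where it depends on averages only, see [fluxE]. *)
Let transfer k y0 y1 := (A k y0 + A k y1) / 2 * (G k y1 - G k y0)
  + (A k y1 - A k y0) / 2 * `|G k y1 - G k y0|.

Let mE k i : @m k i = A k (point i) * h k ^+ d.
Proof. by rewrite /A divfK// expf_neq0. Qed.

Let gradE k (i : vertex (L k)) : 0 < A k (point i) ->
  energy_gradient V W beta (@m k) i = G k (point i)
    + beta * (ln (h k ^+ d) + 1).
Proof.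
move=> Ai; have hd : 0 < h k ^+ d by rewrite exprn_gt0.
rewrite energy_gradientE//; last by rewrite mE mulr_gt0.
by rewrite mE lnM ?posrE//; exact: log_split.
Qed.

Let fluxE k (i j : vertex (L k)) : 0 < A k (point i) -> 0 < A k (point j) ->
  upwind_flux V W beta (@m k) i j =
  - (h k ^+ d / h k ^+ 2 * transfer k (point i) (point j)).
Proof.
move=> Ai Aj; rewrite /upwind_flux !gradE// upwind_shift !mE.
exact: (@flux_split R (A k (point i)) (A k (point j))
  (G k (point j) - G k (point i))
  `|G k (point j) - G k (point i)| (h k ^+ d) (h k) (hn0 k)).
Qed.

Let succ_point k v (j : vertex (L k)) : successor v (i_ k) j ->
  point j = x_ k + h k *: ev v.
Proof. by move=> /successor_pointP. Qed.

Let pred_point k v (j : vertex (L k)) : successor v j (i_ k) ->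
  point j = x_ k + (- h k) *: ev v.
Proof. by move=> /successor_pointP ij; rewrite scaleNr /x_ ij addrK. Qed.

Let hN_cvg : - h k @[k --> \oo] --> 0.
Proof. by rewrite -oppr0; apply: cvgN. Qed.

Let hNn0 k : - h k != 0. Proof. by rewrite oppr_eq0. Qed.

Let A_step v (e : nat -> R) : e k @[k --> \oo] --> 0 -> (forall k, e k != 0) ->
  A k (x_ k + e k *: ev v) @[k --> \oo] --> rho t x.
Proof. by move=> e0 en0; exact: cvg_step e0 en0 A_cvg (@A_quot v e e0 en0). Qed.

Let cst_cvg (c : R) : (fun=> c) k @[k --> \oo] --> c.
Proof. exact: cvg_cst. Qed.

Let transfer_cvg v : transfer k (x_ k) (x_ k + h k *: ev v) / h k
  @[k --> \oo] -->
  rho t x * phi1 v.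
Proof.
have cA := @A_step v h h_cvg hn0.
have cG := @G_quot v h h_cvg hn0.
have c1 := cvg_seqM (cvg_seqM (cvg_seqD A_cvg cA) (@cst_cvg 2^-1)) cG.
have c2 := cvg_seqM (cvg_seqM h_cvg (@A_quot v h h_cvg hn0))
  (cvg_seqM (@cst_cvg 2^-1) (cvg_seq_norm cG)).
have := cvg_seqD c1 c2; move=> /eq_cvg_seq; apply => [|k].
  have -> : (rho t x + rho t x) * 2^-1 = rho t x by field.
  by rewrite !mul0r addr0.
rewrite normrM normfV (gtr0_norm (h_gt0 k)).
exact: transfer_split.
Qed.

Let face_cvg v : face_integral (i_ k) v (current V W beta (rho (t_ k)) v) / h k
  ^+ d.-1
  @[k --> \oo] --> flux_density V W beta rho v t x.
Proof.
pose s_ k := x_ k 0 v + h k / 2.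
have cs : s_ k @[k --> \oo] --> x 0 v.
  have := cvg_seqD (@coord_cvg R d v x_ x x_cvg)
    (cvg_seqM h_cvg (@cst_cvg 2^-1)).
  by move=> /eq_cvg_seq; apply => [|//]; rewrite mul0r addr0.
have cf k := @flux_density_continuous R d V W beta rho T a b V_smooth
  W_smooth sol
  a_gt0 b_ltT dom v (t_ k) (t_ab k).
have := @cube_average_cvg R d.-1
  (fun k z => flux_density V W beta rho v (t_ k) (insert_coord v (s_ k) z))
  (fun k => row_except v (x_ k)) (row_except v x) h
    (flux_density V W beta rho v t x)
  h_gt0 h_cvg (@row_except_cvg R d v x_ x x_cvg).
move=> /(_ _ _)/eq_cvg_seq; apply => [k|z zx||k] //.
- move=> z; apply: continuous_seq => q qz.
  have ci : insert_coord v (s_ k) (q n) @[n --> \oo] --> insert_coord v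
    (s_ k) z.
    by apply: insert_coord_cvg => //; exact: cvg_cst.
  exact: (cvg_comp (fun n => insert_coord v (s_ k) (q n)) _ ci (cf k _)).
- apply: (flux_density_cvg V_smooth W_smooth sol a_gt0 b_ltT dom) => //.
  by rewrite -[X in _ --> X](insert_coordK v); exact: insert_coord_cvg.
- by rewrite face_integralE (currentE V_smooth W_smooth sol a_gt0 b_ltT dom).
Qed.

(** Along the face between [i_ k] and its successor the flux per area tends to
    the exact current at the limit point, and so does the average of the exact
    current over the face. *)
Lemma flux_consistent v (eps : R) : 0 < eps -> \forall k \near \oo,
  forall j : vertex (L k), successor v (i_ k) j ->
  `|upwind_flux V W beta (@cell_mass R d (L k) (rho (t_ k))) (i_ k) j -
    face_integral (i_ k) v (current V W beta (rho (t_ k)) v)| <=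
  eps * spacing (L k) ^+ d.-1.
Proof.
move=> eps0.
have lim0 : transfer k (x_ k) (x_ k + h k *: ev v) / h k +
  face_integral (i_ k) v (current V W beta (rho (t_ k)) v) / h k ^+ d.-1
  @[k --> \oo] --> 0.
  have := cvg_seqD (@transfer_cvg v) (@face_cvg v).
  move=> /eq_cvg_seq; apply => [|//].
  by rewrite /flux_density /phi1; field; rewrite gt_eqF.
have /cvgrPdist_le/(_ _ eps0) near1 := lim0.
apply: filterS3 near1 (cvg_near_gt0 r_gt0 A_cvg)
  (cvg_near_gt0 r_gt0 (@A_step v h h_cvg hn0)) => k k1 k2 k3 j ij.
have pj := succ_point ij.
have k3' : 0 < A k (point j) by rewrite pj.
rewrite (fluxE k2 k3') pj.
have hd : h k ^+ d = h k * h k ^+ d.-1 by rewrite -exprS prednK.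
have hp : 0 < h k ^+ d.-1 by rewrite exprn_gt0.
rewrite -[spacing (L k)]/(h k).
have -> : - (h k ^+ d / h k ^+ 2 * transfer k (point (i_ k))
  (x_ k + h k *: ev v)) -
    face_integral (i_ k) v (current V W beta (rho (t_ k)) v) =
   (0 - (transfer k (x_ k) (x_ k + h k *: ev v) / h k +
  face_integral (i_ k) v (current V W beta (rho (t_ k)) v) / h k ^+ d.-1)) * h k
    ^+ d.-1.
  by rewrite hd; apply: face_split => //; rewrite gt_eqF.
by rewrite normrM (gtr0_norm hp) ler_pM2r.
Qed.

Let balance_cvg v :
  (transfer k (x_ k) (x_ k + h k *: ev v)
    + transfer k (x_ k) (x_ k + (- h k) *: ev v)) / h k ^+ 2
  @[k --> \oo] --> rho t x * phi2 v + rho_partial rho [:: v] t x * phi1 v.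
Proof.
have cGp := @G_quot v h h_cvg hn0.
have cGm := @G_quot v (fun k => - h k) hN_cvg hNn0.
have cAp := @A_quot v h h_cvg hn0.
have cAm := @A_quot v (fun k => - h k) hN_cvg hNn0.
have c1 := cvg_seqM A_cvg (@G_second v h h_cvg hn0).
have c2 := cvg_seqM (cvg_seqM cAp cGp) (@cst_cvg 2^-1).
have c3 := cvg_seqM (cvg_seqM cAm cGm) (@cst_cvg 2^-1).
have c4 := cvg_seqM (cvg_seqM cAp (cvg_seq_norm cGp)) (@cst_cvg 2^-1).
have c5 := cvg_seqM (cvg_seqM cAm (cvg_seq_norm cGm)) (@cst_cvg (- 2^-1)).
have := cvg_seqD c1 (cvg_seqD (cvg_seqD c2 c3) (cvg_seqD c4 c5)).
move=> /eq_cvg_seq; apply => [|k]; first by field.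
have E : x_ k - h k *: ev v = x_ k + (- h k) *: ev v by rewrite scaleNr.
rewrite E !normrM !normfV normrN (gtr0_norm (h_gt0 k)).
exact: balance_split.
Qed.

(** The rate of change of the cell average tends to the time derivative of the
    density, and the balance of the numerical fluxes tends to the right-hand
    side of the equation. *)
Lemma scheme_consistent (eps : R) : 0 < eps -> \forall k \near \oo,
  `|derive1 (fun s => @cell_mass R d (L k) (rho s) (i_ k)) (t_ k) -
    fokker_planck_scheme V W beta (@cell_mass R d (L k) (rho (t_ k))) (i_ k)| <=
  eps * spacing (L k) ^+ d.
Proof.
move=> eps0.
pose B k v := (transfer k (x_ k) (x_ k + h k *: ev v) +
   transfer k (x_ k) (x_ k + (- h k) *: ev v)) / h k ^+ 2.
have cB : \sum_v B k v @[k --> \oo] -->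
    \sum_v (rho t x * phi2 v + rho_partial rho [:: v] t x * phi1 v).
  by apply: cvg_seq_sum => v; exact: balance_cvg.
have cD := average_time_cvg rho_smooth t_T tT t_cvg x_cvg h_gt0 h_cvg.
have lim0 : integral_on (cube (x_ k) (h k)) (rho_rate rho (t_ k)) / h k ^+ d +
    (-1) * (\sum_v B k v) @[k --> \oo] --> 0.
  have := cvg_seqD cD (cvg_seqM (@cst_cvg (-1)) cB).
  move=> /eq_cvg_seq; apply => [|//].
  rewrite (equationE V_smooth W_smooth sol a_gt0 b_ltT dom)// mulN1r -sumrB
    big1// => v _.
  exact: (balance_limit _ _ _ _ _ (lt0r_neq0 r_gt0)).
have /cvgrPdist_le/(_ _ eps0) near1 := lim0.
have nearA : \forall k \near \oo, 0 < A k (x_ k) /\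
    (forall v, 0 < A k (x_ k + h k *: ev v) /\
      0 < A k (x_ k + (- h k) *: ev v)).
  apply: filterI; first exact: cvg_near_gt0 r_gt0 A_cvg.
  pose Q (v : 'I_d) : set nat := [set k |
    0 < A k (x_ k + h k *: ev v) /\ 0 < A k (x_ k + (- h k) *: ev v)].
  have nQ v : \forall k \near \oo, Q v k.
    apply: filterI; first exact: cvg_near_gt0 r_gt0 (@A_step v h h_cvg hn0).
    exact: cvg_near_gt0 r_gt0 (@A_step v (fun k => - h k) hN_cvg hNn0).
  have := @filter_forall nat 'I_d Q \oo _ nQ.
  exact.
have near_nb : \forall k \near \oo, forall v,
    (exists j, successor v (i_ k) j) /\ (exists j, successor v j (i_ k)).
  have /cvgrPdist_le/(_ _ ltr01) nx := x_cvg.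
  have /cvgrPdist_le/(_ _ ltr01) nh := h_cvg.
  have nc := L_refining.2 (`|x| + 1 + 1).
  apply: filterS3 nx nh nc => k kx kh kc v.
  apply: (@successor_exists R d (L k) (i_ k) v (`|x| + 1)).
    rewrite -(subrK x (point (i_ k))) (le_trans (ler_normD _ _))// addrC lerD2l.
    by rewrite distrC.
  move=> p pr; apply: kc; rewrite (le_trans pr)// lerD2l.
  by move: kh; rewrite sub0r normrN gtr0_norm.
apply: filterS3 near1 nearA near_nb => k k1 [A0 Apm] nb.
have [ip ipP] := choice (fun v => (nb v).1).
have [im imP] := choice (fun v => (nb v).2).
have hp : 0 < h k ^+ d by rewrite exprn_gt0.
have -> : derive1 (fun s => @cell_mass R d (L k) (rho s) (i_ k)) (t_ k) =
   integral_on (cube (x_ k) (h k)) (rho_rate rho (t_ k)).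
  exact: (derive_cube_mass rho_smooth (x_ k) (ltW (h_gt0 k)) (t_T k)).
have -> : fokker_planck_scheme V W beta (@cell_mass R d (L k) (rho (t_ k)))
  (i_ k) =
    h k ^+ d * \sum_v B k v.
  rewrite scheme_upwind_flux (adjacent_sum _ ipP imP) mulr_sumr -sumrN.
  apply: eq_bigr => v _; have [Ap Am] := Apm v.
  have pp := succ_point (ipP v); have pm := pred_point (imP v).
  have Ap' : 0 < A k (point (ip v)) by rewrite pp.
  have Am' : 0 < A k (point (im v)) by rewrite pm.
  by rewrite (fluxE A0 Ap') (fluxE A0 Am') pp pm; exact: balance_fluxE.
rewrite -[spacing (L k)]/(h k).
rewrite (residual_split _ _ (lt0r_neq0 hp)).
by rewrite normrM normrN (gtr0_norm hp) ler_pM2r.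
Qed.

End limit.

(** * Uniformity in space and time *)

(** If uniformity failed, there would be bad lattices with arbitrarily large
    index, each with a bad time in [a, b] and a bad vertex in the ball of
    radius [r]. By compactness these accumulate at some time and point; along a
    subsequence they converge, which contradicts the sequential statement. *)
Lemma sequential_to_uniform {R : realType} {d : nat}
    (Q : forall L : lattice R d, R -> vertex L -> Prop)
    (L : nat -> lattice R d) (a b r : R) : refining L ->
  (forall (L' : nat -> lattice R d) (t_ : nat -> R) (t : R)
      (i_ : forall k, vertex (L' k)) (x : 'rV[R]_d),
    refining L' -> (forall k, a <= t_ k <= b) -> a <= t <= b ->
    t_ k @[k --> \oo] --> t -> point (i_ k) @[k --> \oo] --> x ->
    \forall k \near \oo, Q (L' k) (t_ k) (i_ k)) ->
  \forall k \near \oo, forall t (i : vertex (L k)), a <= t <= b ->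
    `|point i| <= r -> Q (L k) t i.
Proof.
move=> [h0 cov] HQ; apply: contrapT => nQ.
have bad N : exists s : {k : nat & (R * vertex (L k))%type}, (N <= tag s)%N /\
    [/\ a <= (tagged s).1 <= b, `|point (tagged s).2| <= r &
      ~ Q (L (tag s)) (tagged s).1 (tagged s).2].
  apply: contrapT => /forallNP nN; apply: nQ; exists N => // k /= Nk t i tab ir.
  apply: contrapT => nQk; apply: (nN
    (Tagged (fun k => (R * vertex (L k))%type) (t, i))).
  by split.
have [s sP] := choice bad.
(* [cube 0 (2 * r)] is the closed ball of radius [r] for the sup norm *)
pose u N : R * 'rV[R]_d := ((tagged (s N)).1, point (tagged (s N)).2).
pose K : set (R * 'rV[R]_d) := `[a, b]%classic `*` cube 0 (2 * r).
have cK : compact K.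
  by apply: compact_setX; [exact: segment_compact|exact: compact_cube].
have uK N : K (u N).
  have [_ [tab ir _]] := sP N; split=> /=; first by rewrite in_itv.
  move=> v; rewrite [X in _ - X]mxE subr0 (_ : 2 * r / 2 = r); last by field.
  have r0 : 0 <= r by rewrite (le_trans _ ir).
  exact: (rV_normP _ r0).1.
have nK : (u @ \oo) K by exact: (@filterS _ \oo _ setT _ (fun N _ => uK N)
  filterT).
have [p [Kp clp]] := cK (u @ \oo) _ nK.
have pick n : exists N, (n <= N)%N /\ ball p n.+1%:R^-1 (u N).
  have e0 : 0 < n.+1%:R^-1 :> R by rewrite invr_gt0.
  have [|_ [[N nN <-] pN]] :=
    clp (u @` [set N | (n <= N)%N]) (ball p n.+1%:R^-1) _
    (nbhsx_ballx p _ e0).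
  - by exists n => // N /= nN; exists N.
  - by exists N.
have [nu nuP] := choice pick.
pose kap n := tag (s (nu n)).
have kap_ge n : (n <= kap n)%N.
  by rewrite (leq_trans (nuP n).1)// (sP (nu n)).1.
have near_kap (P : nat -> Prop) : (\forall k \near \oo, P k) ->
    \forall n \near \oo, P (kap n).
  by move=> [N _ HN]; exists N => // n /= Nn; apply: HN;
    exact: leq_trans (kap_ge n).
have harm e : 0 < e -> \forall n \near \oo, n.+1%:R^-1 < e :> R.
  move=> e0; have : (fun k : nat => k.+1%:R^-1 : R) @ \oo --> 0
    by exact: cvg_harmonic.
  move=> /cvgrPdist_lt /(_ _ e0); apply: filterS => k.
  by rewrite sub0r normrN ger0_norm// invr_ge0.
have [tp xp] := Kp.
have := HQ (fun n => L (kap n)) (fun n => (u (nu n)).1) p.1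
  (fun n => (tagged (s (nu n))).2) p.2.
move=> [].
- split; last by move=> r'; exact: (near_kap _ (cov r')).
  apply/cvgrPdist_le => e e0.
  exact: (near_kap _ ((cvgrPdist_le _ _).1 h0 _ e0)).
- by move=> k; have [_ []] := sP (nu k).
- by move: tp; rewrite /= in_itv.
- apply/cvgrPdist_lt => e /harm; apply: filterS => n ne.
  have [_ [b1 _]] := nuP n; exact: lt_trans ne.
- apply/cvgrPdist_lt => e /harm; apply: filterS => n ne.
  have [_ [_ b2]] := nuP n; apply: lt_trans ne.
  by move: b2; rewrite mx_norm_ball.
- by move=> N _ /(_ N (leqnn N)); have [_ []] := sP (nu N).
Qed.

Theorem theorem11 (R : realType) (d : nat)
    (V : 'rV[R]_d -> R) (W : 'rV[R]_d -> 'rV[R]_d -> R) (beta : R)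
    (d_gt0 : (0 < d)%N)
    (V_smooth : smooth_on setT V)
    (W_smooth : smooth_on setT (fun p : 'rV[R]_d * 'rV[R]_d => W p.1 p.2))
    (W_sym : forall x y, W x y = W y x)
    (beta_gt0 : 0 < beta) :
  consistent_finite_volume V W beta (fokker_planck_scheme V W beta).
Proof.
exists (@upwind_flux R d V W beta); split.
- by move=> L m i j _; exact: upwind_flux_antisym.
- by move=> L m i; exact: scheme_upwind_flux.
move=> T rho a b L sol a0 _ bT dom rL r eps eps0.
apply: (@sequential_to_uniform R d (fun L t i =>
  (forall (v : 'I_d) (j : vertex L), successor v i j ->
    `|upwind_flux V W beta (@cell_mass R d L (rho t)) i j -
      face_integral i v (current V W beta (rho t) v)| <=
        eps * spacing L ^+ d.-1) /\
  `|derive1 (fun s => @cell_mass R d L (rho s) i) t -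
    fokker_planck_scheme V W beta (@cell_mass R d L (rho t)) i| <=
  eps * spacing L ^+ d) L a b r rL).
move=> L' t_ t i_ x rL' t_ab tab tt xx; apply: filterI.
  pose Q (v : 'I_d) : set nat := [set k | forall j : vertex (L' k),
    successor v (i_ k) j ->
    `|upwind_flux V W beta (@cell_mass R d (L' k) (rho (t_ k))) (i_ k) j -
      face_integral (i_ k) v (current V W beta (rho (t_ k)) v)| <=
    eps * spacing (L' k) ^+ d.-1].
  have nQ v : \forall k \near \oo, Q v k.
    exact: (flux_consistent d_gt0 V_smooth W_smooth W_sym sol a0 bT dom rL' t_ab
      tab tt xx).
  have := @filter_forall nat 'I_d Q \oo _ nQ.
  exact.
exact: (scheme_consistent V_smooth W_smooth W_sym sol a0 bT dom rL' t_ab tab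
  tt xx).
Qed.
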